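(* Let $\mathcal{G}$ be a sufficiently generic filter on $\mathbb{P}$. Then there is an infinite $\vec{R}^{\mathcal{G}}$-cohesive set $C$ such that $(\vec{R}^{\mathcal{G}} \oplus C)'$ is not of PA degree relative to $\mathbf{0}'$. In particular, $(\vec{R}^{\mathcal{G}} \oplus C)'$ is not of PA degree relative to $\deg(\vec{R}^{\mathcal{G}})'$, so $\vec{R}^{\mathcal{G}}$ is not a universal instance of $\mathsf{COH}$.
   Context: $\mathbb{P}$ (Cohen forcing with locks) is the following notion of forcing. A condition is a tuple $p = (\sigma_0,\ldots,\sigma_{k-1},f)$ where $\sigma_0,\ldots,\sigma_{k-1}$ are finite binary strings and $f$ is a function from $\{0,\ldots,k-1\}$ to $\{0,1,u\}$. A condition $q = (\tau_0,\ldots,\tau_{\ell-1},g)$ extends $p$, written $q \leq p$, if: $\ell\geq k$; $g$ extends $f$ as a function; $\sigma_i \preceq \tau_i$ (initial segment) for all $i<k$; and for all $i<k$ with $f(i)\in\{0,1\}$ and every $x$ with $|\sigma_i|\leq x<|\tau_i|$, we have $\tau_i(x)=f(i)$. For a generic filter $\mathcal{G}$ on $\mathbb{P}$, let $R^{\mathcal{G}}_i = \bigcup\{\sigma_i : (\sigma_0,\ldots,\sigma_{k-1},f)\in\mathcal{G},\ i<k\}$ (an element of $2^\omega$, identified with a subset of $\omega$) and $\vec{R}^{\mathcal{G}} = \langle R^{\mathcal{G}}_0,R^{\mathcal{G}}_1,\ldots\rangle$ (coded as a single set). ''Sufficiently generic'' means that $\mathcal{G}$ meets all sets in some suitable fixed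 countable collection of dense subsets of $\mathbb{P}$. Write $X\subseteq^* Y$ if $X\setminus F\subseteq Y$ for some finite $F$. A set $C$ is cohesive for $\vec{R}=\langle R_0,R_1,\ldots\rangle$ (or $\vec{R}$-cohesive) if for every $n$, either $C\subseteq^* R_n$ or $C\subseteq^*\overline{R}_n$. $\mathsf{COH}$ is the problem whose instances are sequences $\vec{R}$ of subsets of $\omega$ and whose solutions are the infinite cohesive sets for $\vec{R}$. For a set $A$, an $A$-computable instance $\vec{R}$ of $\mathsf{COH}$ is universal (among $A$-computable instances) if for every $A$-computable instance $\vec{S}$ of $\mathsf{COH}$ and every solution $C$ to $\vec{R}$, $A\oplus C$ computes a solution to $\vec{S}$. Here universality of $\vec{R}^{\mathcal{G}}$ is understood with $A=\vec{R}^{\mathcal{G}}$. A set $Y$ is of PA degree relative to (the degree of) a set $Z$ if $Y$ computes a path through every infinite $Z$-computable subtree of $2^{<\omega}$. The prime denotes the Turing jump. *)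

(* Defs.v *)
From mathcomp Require Import all_boot.
From mathcomp Require Import boolp classical_sets functions cardinality.
From Stdlib Require Cantor.

Set Implicit Arguments.
Unset Strict Implicit.
Unset Printing Implicit Defensive.

Local Open Scope classical_set_scope.

Definition npair (x y : nat) : nat := Cantor.to_nat (x, y).
Definition nfst (n : nat) : nat := (Cantor.of_nat n).1.
Definition nsnd (n : nat) : nat := (Cantor.of_nat n).2.

Lemma npairK1 x y : nfst (npair x y) = x.
Proof. by rewrite /nfst /npair Cantor.cancel_of_to. Qed.

Lemma npairK2 x y : nsnd (npair x y) = y.
Proof. by rewrite /nsnd /npair Cantor.cancel_of_to. Qed.

Lemma npair_inj x y x' y' : npair x y = npair x' y' -> x = x' /\ y = y'.
Proof.
by move=> h; split; [rewrite -(npairK1 x y) h npairK1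
                   | rewrite -(npairK2 x y) h npairK2].
Qed.

(** Kleene's partial recursive functions relative to an oracle. All functions
    are unary; several arguments are passed through [npair]. *)
Inductive code : Type :=
| Zero | Succ | Fst | Snd | Oracle
| Pair of code & code
| Comp of code & code
| Rec of code & code
| Mu of code.

(** [eval X c n m]: the program [c] with oracle [X] halts on [n] with output
    [m]. In [Rec f g], [h] lists the successive values of the primitive
    recursion [h 0 = f a], [h (j+1) = g <a, <j, h j>>], where [n = <a, k>]. *)
Fixpoint eval (X : set nat) (c : code) (n m : nat) {struct c} : Prop :=
  match c with
  | Zero => m = 0
  | Succ => m = n.+1
  | Fst => m = nfst n
  | Snd => m = nsnd n
  | Oracle => m = (n \in X)
  | Pair f g => exists a b, [/\ eval X f n a, eval X g n b & m = npair a b]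
  | Comp f g => exists2 a, eval X g n a & eval X f a m
  | Rec f g => exists h : nat -> nat,
      [/\ eval X f (nfst n) (h 0),
          forall j, j < nsnd n ->
            eval X g (npair (nfst n) (npair j (h j))) (h j.+1)
        & m = h (nsnd n)]
  | Mu f => eval X f (npair n m) 0 /\
      forall j, j < m -> exists v, eval X f (npair n j) v.+1
  end.

Lemma eval_fun X c n m m' : eval X c n m -> eval X c n m' -> m = m'.
Proof.
elim: c n m m' => [||||| f IHf g IHg | f IHf g IHg | f IHf g IHg | f IHf] n m m' /=;
  try by move=> -> ->.
- by move=> [a [b [fa gb ->]]] [a' [b' [fa' gb' ->]]];
     rewrite (IHf _ _ _ fa fa') (IHg _ _ _ gb gb').
- by move=> [a ga fm] [a' ga' fm']; move: fm'; rewrite -(IHg _ _ _ ga ga');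
     exact: IHf.
- move=> [h [h0 hS ->]] [h' [h0' hS' ->]].
  suff H j : j <= nsnd n -> h j = h' j by exact: H.
  elim: j => [_|j IHj jn]; first exact: IHf h0 h0'.
  move: (hS' _ jn); rewrite -(IHj (ltnW jn)); exact: IHg (hS _ jn).
- move=> [fm lm] [fm' lm'].
  by case: (ltngtP m m') => // /[dup] h; [move/lm'|move/lm] => -[v fv];
     [have := IHf _ _ _ fv fm | have := IHf _ _ _ fv fm'].
Qed.

Fixpoint code_num (c : code) : nat :=
  match c with
  | Zero => npair 0 0
  | Succ => npair 1 0
  | Fst => npair 2 0
  | Snd => npair 3 0
  | Oracle => npair 4 0
  | Pair f g => npair 5 (npair (code_num f) (code_num g))
  | Comp f g => npair 6 (npair (code_num f) (code_num g))
  | Rec f g => npair 7 (npair (code_num f) (code_num g))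
  | Mu f => npair 8 (code_num f)
  end.

Lemma code_num_inj : injective code_num.
Proof.
elim=> [||||| f IHf g IHg | f IHf g IHg | f IHf g IHg | f IHf] [||||| f' g' | f' g' | f' g' | f'] //=
  /npair_inj [] // _; try by move=> /npair_inj [/IHf -> /IHg ->].
by move=> /IHf ->.
Qed.

(** The [e]-th partial computable function relative to [X]; numbers which are
    not Goedel numbers index the nowhere defined function. *)
Definition phi (X : set nat) (e n m : nat) : Prop :=
  exists2 c, code_num c = e & eval X c n m.

Definition jump (X : set nat) : set nat := [set e | exists m, phi X e e m].

Definition turing_le (X Y : set nat) : Prop :=
  exists c, forall n, eval Y c n (n \in X).

Notation "X <=T Y" := (turing_le X Y) (at level 70, no associativity).

Lemma turing_le_refl X : X <=T X.
Proof. by exists Oracle. Qed.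

Definition join (X Y : set nat) : set nat :=
  [set n.*2 | n in X] `|` [set n.*2.+1 | n in Y].

Fixpoint str_num (s : seq bool) : nat :=
  if s is b :: s' then (npair b (str_num s')).+1 else 0.

Lemma str_num_inj : injective str_num.
Proof.
elim=> [|b s IHs] [|b' s'] //= [/npair_inj [bb' /IHs ->]].
by case: b b' bb' => -[].
Qed.

Definition tree (T : set (seq bool)) : Prop :=
  forall s t, prefix s t -> T t -> T s.

Definition is_path (T : set (seq bool)) (P : set nat) : Prop :=
  forall n, T (mkseq (fun i => i \in P) n).

Definition pa_relative (Y Z : set nat) : Prop :=
  forall T : set (seq bool), tree T -> infinite_set T ->
    [set str_num s | s in T] <=T Z ->
    exists2 P, is_path T P & P <=T Y.

Definition almost_subset (X Y : set nat) : Prop :=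
  exists2 F : set nat, finite_set F & X `\` F `<=` Y.

Definition cohesive (R : nat -> set nat) (C : set nat) : Prop :=
  forall n, almost_subset C (R n) \/ almost_subset C (~` R n).

Definition coh_solution (R : nat -> set nat) (C : set nat) : Prop :=
  infinite_set C /\ cohesive R C.

Definition seq_set (R : nat -> set nat) : set nat :=
  [set z | R (nfst z) (nsnd z)].

Definition coh_universal (A : set nat) (R : nat -> set nat) : Prop :=
  seq_set R <=T A /\
  forall S : nat -> set nat, seq_set S <=T A ->
  forall C, coh_solution R C ->
  exists2 D, coh_solution S D & D <=T join A C.

(** The condition (sigma_0, ..., sigma_{k-1}, f) is the list of the pairs
    (sigma_i, f(i)) for i < k; the lock value u is [None]. *)
Definition condition : Type := seq (seq bool * option bool).

Definition str (p : condition) (i : nat) : seq bool := (nth ([::], None) p i).1.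
Definition lock (p : condition) (i : nat) : option bool :=
  (nth ([::], None) p i).2.

Definition extends (q p : condition) : Prop :=
  size p <= size q /\
  forall i, i < size p ->
    [/\ lock q i = lock p i,
        prefix (str p i) (str q i)
      & forall b, lock p i = Some b ->
        forall x, size (str p i) <= x < size (str q i) ->
        nth false (str q i) x = b].

Definition dense (D : set condition) : Prop :=
  forall p, exists2 q, D q & extends q p.

Definition is_filter (G : set condition) : Prop :=
  [/\ G !=set0,
      forall p q, G q -> extends q p -> G p
    & forall p q, G p -> G q -> exists r, [/\ G r, extends r p & extends r q]].

Definition for_sufficiently_generic (Q : set condition -> Prop) : Prop :=
  exists DD : set (set condition),
    [/\ countable DD,
        forall D, DD D -> dense D
      & forall G, is_filter G -> (forall D, DD D -> G `&` D !=set0) -> Q G].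

Definition generic_seq (G : set condition) (i : nat) : set nat :=
  [set x | exists p, [/\ G p, i < size p, x < size (str p i)
                       & nth false (str p i) x = true]].

(* Main.v *)
Require Import Defs.
From mathcomp Require Import all_boot.
From mathcomp Require Import boolp classical_sets functions cardinality.
From mathcomp Require Import zify.
From Stdlib Require Cantor.

(** Force with pairs (t, p), where p is a condition and t an initial segment of
    the cohesive set C, whose new elements must lie in the locked-to-1 columns of
    p and outside all its other columns. As G is generic, a generic chain of such
    pairs can be chosen with all its second components in G; write X for the
    join of the sequence and C. That (t, p) forces a computation from the jump
    of X is the existence of finite data (a computation, positive answers already
    decided) together with a universal statement (negative answers never
    refuted by an extension), over a computable extension relation.

    Hence there is a computable sequence of sets S_e, with e = <c, (t, p)>, where
    S_e follows the least value forced below (t, p) for program c at input e that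
    is not yet refuted, and answers the opposite. If a value is forced by some
    extension, S_e is finite or cofinite on the wrong side, so a generic chain
    entering that extension prevents c from separating
    {e : S_e cofinite} from {e : S_e finite}; if none is, program c diverges at e.
    So no separator is computable in the jump of X. The paths of a suitable tree,
    computable in every jump, are such separators, and so is the limit along any
    cohesive set for S, which is computable in the jump of that set. *)

Set Implicit Arguments.
Unset Strict Implicit.
Unset Printing Implicit Defensive.

Local Open Scope classical_set_scope.

(** * Computable functions *)

Lemma npairK n : npair (nfst n) (nsnd n) = n.
Proof. by rewrite /npair /nfst /nsnd -surjective_pairing Cantor.cancel_to_of. Qed.

Lemma leq_npair x y : x + y <= npair x y.
Proof. by have := Cantor.to_nat_non_decreasing x y; rewrite /npair; lia. Qed.

Lemma npair_eq a b c d : (npair a b == npair c d) = (a == c) && (b == d).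
Proof.
apply/eqP/andP => [/npair_inj [-> ->]|[/eqP -> /eqP ->]] //; by rewrite !eqxx.
Qed.

Lemma nfst0 : nfst 0 = 0. Proof. by []. Qed.
Lemma nsnd0 : nsnd 0 = 0. Proof. by []. Qed.

Opaque npair nfst nsnd.

Definition recf (X : set nat) (f : nat -> nat) : Prop :=
  exists c, forall n, eval X c n (f n).

Notation recb X P := (recf X (fun n => nat_of_bool (P n))).

Lemma eq_recf X f g : f =1 g -> recf X f -> recf X g.
Proof. by move=> fg [c cP]; exists c => n; rewrite -fg. Qed.

Lemma eq_recb X (P Q : nat -> bool) : P =1 Q -> recb X P -> recb X Q.
Proof. by move=> PQ; apply: eq_recf => n; rewrite PQ. Qed.

Lemma turing_leE X Y : (X <=T Y) = recb Y (fun n => n \in X).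
Proof. by []. Qed.

Section Closure.
Context (X : set nat).
Implicit Types f g : nat -> nat.

Lemma recf_id : recf X (fun n => n).
Proof.
by exists (Pair Fst Snd) => n /=; exists (nfst n), (nsnd n); rewrite npairK.
Qed.

Lemma recf_cst a : recf X (fun=> a).
Proof.
elim: a => [|a [c cP]]; first by exists Zero.
by exists (Comp Succ c) => n /=; exists a.
Qed.

Lemma recf_comp f g : recf X f -> recf X g -> recf X (fun n => f (g n)).
Proof. by move=> [c cP] [d dP]; exists (Comp c d) => n /=; exists (g n). Qed.

Lemma recf_oracle f : recf X f -> recb X (fun n => f n \in X).
Proof. by move=> [c cP]; exists (Comp Oracle c) => n /=; exists (f n). Qed.

Lemma recf_succ f : recf X f -> recf X (fun n => (f n).+1).
Proof. by apply: recf_comp; exists Succ. Qed.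

Lemma recf_fst f : recf X f -> recf X (fun n => nfst (f n)).
Proof. by apply: recf_comp; exists Fst. Qed.

Lemma recf_snd f : recf X f -> recf X (fun n => nsnd (f n)).
Proof. by apply: recf_comp; exists Snd. Qed.

Lemma recf_pair f g : recf X f -> recf X g -> recf X (fun n => npair (f n) (g n)).
Proof.
by move=> [c cP] [d dP]; exists (Pair c d) => n /=; exists (f n), (g n).
Qed.

Lemma recf_rec (s : nat -> nat -> nat -> nat) f (k : nat -> nat) :
  recf X f -> recf X k ->
  recf X (fun z => s (nfst z) (nfst (nsnd z)) (nsnd (nsnd z))) ->
  recf X (fun n => nat_rect (fun=> nat) (f n) (s n) (k n)).
Proof.
move=> [cf fP] ck [cs sP].
pose F z := nat_rect (fun=> nat) (f (nfst z)) (s (nfst z)) (nsnd z).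
suff F_rec : recf X F.
  apply: (@eq_recf X (fun n => F (npair n (k n)))) => [n|].
    by rewrite /F npairK1 npairK2.
  by apply: recf_comp => //; apply: recf_pair => //; apply: recf_id.
exists (Rec cf cs) => z /=.
exists (fun j => nat_rect (fun=> nat) (f (nfst z)) (s (nfst z)) j); split=> //.
move=> j _ /=.
by have := sP (npair (nfst z) (npair j (nat_rect (fun=> nat) (f (nfst z))
  (s (nfst z)) j))); rewrite !(npairK1, npairK2).
Qed.

Lemma recf_iter (s : nat -> nat -> nat) (k a : nat -> nat) :
  recf X k -> recf X (fun z => s (nfst z) (nsnd z)) -> recf X a ->
  recf X (fun n => iter (k n) (s n) (a n)).
Proof.
move=> ck cs ca; apply: (@eq_recf X
  (fun n => nat_rect (fun=> nat) (a n) (fun _ => s n) (k n))) => [n|].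
  by elim: (k n) => //= j ->.
apply: recf_rec => //.
apply: (@eq_recf X (fun z => (fun z => s (nfst z) (nsnd z))
  (npair (nfst z) (nsnd (nsnd z))))) => [z|]; first by rewrite npairK1 npairK2.
apply: (recf_comp cs); apply: recf_pair; first exact: recf_fst recf_id.
by apply: recf_snd; apply: recf_snd; apply: recf_id.
Qed.

Lemma recf_mu (Q : nat -> nat -> bool) f :
  recb X (fun z => Q (nfst z) (nsnd z)) ->
  (forall n, Q n (f n)) -> (forall n j, j < f n -> ~~ Q n j) ->
  recf X f.
Proof.
move=> cQ Qf fmin.
(* [Mu] searches for the value 0, so the test is recoded: the iterate is 0 when [Q] holds and 1
   otherwise. *)
have [d dP] : recf X (fun z => iter (Q (nfst z) (nsnd z)) (fun=> 0) 1).
  by apply: recf_iter => //; apply: recf_cst.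
exists (Mu d) => n /=; split=> [|j jn].
  by have := dP (npair n (f n)); rewrite npairK1 npairK2 Qf.
exists 0; have := dP (npair n j).
by rewrite npairK1 npairK2 (negbTE (fmin _ _ jn)).
Qed.

Lemma recf_choose (Q : nat -> nat -> bool) :
  recb X (fun z => Q (nfst z) (nsnd z)) -> (forall n, exists j, Q n j) ->
  exists2 f, recf X f & forall n, Q n (f n).
Proof.
move=> cQ exQ; exists (fun n => ex_minn (exQ n)); last first.
  by move=> n; case: ex_minnP.
apply: (recf_mu cQ) => n; case: ex_minnP => // m _ mmin j jm.
by apply/negP => /mmin; rewrite leqNgt jm.
Qed.

Lemma recf_if (b : nat -> bool) f g :
  recb X b -> recf X f -> recf X g -> recf X (fun n => if b n then f n else g n).
Proof.
move=> cb cf cg; apply: (@eq_recf X (fun n => iter (b n) (fun=> f n) (g n))).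
  by move=> n; case: (b n).
by apply: recf_iter => //; apply: recf_comp => //; apply: recf_fst recf_id.
Qed.

Lemma recb_not b : recb X b -> recb X (fun n => ~~ b n).
Proof.
move=> cb; apply: (@eq_recf X (fun n => if b n then 0 else 1)).
  by move=> n; case: (b n).
by apply: recf_if => //; apply: recf_cst.
Qed.

Lemma recb_and b c : recb X b -> recb X c -> recb X (fun n => b n && c n).
Proof.
move=> cb cc; apply: (@eq_recf X (fun n => if b n then c n : nat else 0)).
  by move=> n; case: (b n).
by apply: recf_if => //; apply: recf_cst.
Qed.

Lemma recb_or b c : recb X b -> recb X c -> recb X (fun n => b n || c n).
Proof.
move=> cb cc; apply: (@eq_recf X (fun n => if b n then 1 else c n)).
  by move=> n; case: (b n).
by apply: recf_if => //; apply: recf_cst.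
Qed.

Lemma recb_imp b c : recb X b -> recb X c -> recb X (fun n => b n ==> c n).
Proof.
move=> cb cc; apply: (@eq_recf X (fun n => if b n then c n : nat else 1)).
  by move=> n; case: (b n).
by apply: recf_if => //; apply: recf_cst.
Qed.

Lemma recb_if b c d :
  recb X b -> recb X c -> recb X d -> recb X (fun n => if b n then c n else d n).
Proof.
move=> cb cc cd; apply: (@eq_recf X
  (fun n => if b n then nat_of_bool (c n) else nat_of_bool (d n))) => [n|].
  by case: (b n).
exact: recf_if.
Qed.

Lemma recf_pred f : recf X f -> recf X (fun n => (f n).-1).
Proof.
move=> cf; apply: (@eq_recf X
  (fun n => nat_rect (fun=> nat) 0 (fun j _ => j) (f n))) => [n|].
  by case: (f n).
apply: (@recf_rec (fun _ j _ => j)) => //; first exact: recf_cst.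
exact/recf_fst/recf_snd/recf_id.
Qed.

Lemma recf_sub f g : recf X f -> recf X g -> recf X (fun n => f n - g n).
Proof.
move=> cf cg; apply: (@eq_recf X (fun n => iter (g n) predn (f n))) => [n|].
  by rewrite iter_predn.
by apply: recf_iter => //; apply: recf_pred; apply: recf_snd; apply: recf_id.
Qed.

Lemma recf_add f g : recf X f -> recf X g -> recf X (fun n => f n + g n).
Proof.
move=> cf cg; apply: (@eq_recf X (fun n => iter (f n) succn (g n))) => [n|].
  by rewrite iter_succn addnC.
by apply: recf_iter => //; apply: recf_succ; apply: recf_snd; apply: recf_id.
Qed.

Lemma recb_leq f g : recf X f -> recf X g -> recb X (fun n => f n <= g n).
Proof.
move=> cf cg; apply: (@eq_recf X (fun n => 1 - (f n - g n))) => [n|].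
  by rewrite -[f n <= g n]/(f n - g n == 0); case: (f n - g n).
by apply: recf_sub; [apply: recf_cst|apply: recf_sub].
Qed.

Lemma recb_eq f g : recf X f -> recf X g -> recb X (fun n => f n == g n).
Proof.
move=> cf cg; apply: (@eq_recb X (fun n => (f n <= g n) && (g n <= f n))) => [n|].
  by rewrite eqn_leq.
by apply: recb_and; apply: recb_leq.
Qed.

Lemma recb_eqb b c : recb X b -> recb X c -> recb X (fun n => b n == c n).
Proof.
move=> cb cc; apply: (@eq_recb X (fun n => (b n : nat) == c n)) => [n|].
  by case: (b n); case: (c n).
exact: recb_eq.
Qed.

Lemma recb_all_iota (P : nat -> nat -> bool) k :
  recf X k -> recb X (fun z => P (nfst z) (nsnd z)) ->
  recb X (fun n => all (P n) (iota 0 (k n))).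
Proof.
move=> ck cP; apply: (@eq_recf X (fun n => nat_rect (fun=> nat) 1
  (fun j h => if P n j then h else 0) (k n))) => [n|].
  elim: (k n) => // j IHj.
  have -> : iota 0 j.+1 = rcons (iota 0 j) j by rewrite -addn1 iotaD cats1.
  by rewrite all_rcons /= IHj; case: (P n j).
apply: (@recf_rec (fun n j h => if P n j then h else 0)) => //.
  exact: recf_cst.
apply: recf_if; last exact: recf_cst; last exact/recf_snd/recf_snd/recf_id.
apply: (@eq_recf X (fun z => (fun z => P (nfst z) (nsnd z) : nat)
  (npair (nfst z) (nfst (nsnd z))))) => [z|]; first by rewrite npairK1 npairK2.
apply: (recf_comp cP); apply: recf_pair; first exact/recf_fst/recf_id.
exact/recf_fst/recf_snd/recf_id.
Qed.

Lemma recb_has_iota (P : nat -> nat -> bool) k :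
  recf X k -> recb X (fun z => P (nfst z) (nsnd z)) ->
  recb X (fun n => has (P n) (iota 0 (k n))).
Proof.
move=> ck cP; apply: (@eq_recb X
  (fun n => ~~ all (fun j => ~~ P n j) (iota 0 (k n)))) => [n|].
  by rewrite all_predC negbK.
by apply: recb_not; apply: recb_all_iota => //; apply: recb_not.
Qed.

End Closure.

(** * Finite lists of numbers, coded by numbers *)

Fixpoint lcode (s : seq nat) : nat :=
  if s is a :: s' then (npair a (lcode s')).+1 else 0.

(** The first argument is fuel for a structural recursion; [w] itself is enough, because tails have
    smaller codes. *)
Fixpoint ldec_rec (k w : nat) : seq nat :=
  match k, w with
  | k'.+1, w'.+1 => nfst w' :: ldec_rec k' (nsnd w')
  | _, _ => [::]
  end.

Definition ldec (w : nat) : seq nat := ldec_rec w w.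

Lemma leq_nsnd w : nsnd w <= w.
Proof. by have := leq_npair (nfst w) (nsnd w); rewrite npairK; lia. Qed.

Lemma ldec_recE k w : w <= k -> ldec_rec k w = ldec w.
Proof.
rewrite /ldec; elim/ltn_ind: w k => -[|w] IHw [|k] //= wk.
have w_lt := leq_nsnd w.
by rewrite !(IHw (nsnd w)) //; lia.
Qed.

Lemma ldecS w : ldec w.+1 = nfst w :: ldec (nsnd w).
Proof. by rewrite /ldec /= ldec_recE ?leq_nsnd. Qed.

Lemma lcodeK : cancel lcode ldec.
Proof. by elim=> //= a s IHs; rewrite ldecS npairK1 npairK2 IHs. Qed.

Lemma ldecK : cancel ldec lcode.
Proof.
elim/ltn_ind => -[|w] IHw //; rewrite ldecS /= IHw ?npairK //.
exact: leq_nsnd.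
Qed.

(** As [0.-1 = 0] and [nsnd 0 = 0], the code of the empty list is its own tail, so iterating past
    the end of a list is harmless. *)
Definition ltail (w : nat) : nat := nsnd w.-1.

Lemma drop_ldec w i : ldec (iter i ltail w) = drop i (ldec w).
Proof.
elim: i w => [|i IHi] w; first by rewrite drop0.
rewrite iterSr IHi; case: w => [|w]; last by rewrite ldecS.
by rewrite /ltail /= nsnd0.
Qed.

Section ListClosure.
Context (X : set nat).

Lemma recf_iter_ltail w i :
  recf X w -> recf X i -> recf X (fun n => iter (i n) ltail (w n)).
Proof.
move=> cw ci; apply: (@recf_iter X (fun=> ltail)) => //.
exact/recf_snd/recf_pred/recf_snd/recf_id.
Qed.

Lemma recf_size w : recf X w -> recf X (fun n => size (ldec (w n))).
Proof.
move=> cw; apply: (@recf_mu X (fun n i => iter i ltail (w n) == 0)).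
- apply: recb_eq; last exact: recf_cst.
  apply: recf_iter_ltail; last exact/recf_snd/recf_id.
  by apply: recf_comp => //; apply/recf_fst/recf_id.
- move=> n; rewrite -(ldecK (iter _ _ _)) drop_ldec drop_size //.
- move=> n i i_lt; rewrite -(ldecK (iter _ _ _)) drop_ldec.
  by rewrite (drop_nth 0).
Qed.

Lemma recf_nth w i :
  recf X w -> recf X i -> recf X (fun n => nth 0 (ldec (w n)) (i n)).
Proof.
move=> cw ci; apply: (@eq_recf X
  (fun n => nfst (iter (i n) ltail (w n)).-1)) => [n|].
  rewrite -[i n in RHS]addn0 -nth_drop -drop_ldec.
  by case: (iter _ _ _) => [|m]; rewrite ?nfst0 // ldecS.
exact/recf_fst/recf_pred/recf_iter_ltail.
Qed.

Lemma all_nth_iota (P : pred nat) s :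
  all P s = all (fun i => P (nth 0 s i)) (iota 0 (size s)).
Proof. by rewrite -{1}(mkseq_nth 0 s) all_map. Qed.

Lemma recb_all (P : nat -> nat -> bool) w :
  recf X w -> recb X (fun z => P (nfst z) (nsnd z)) ->
  recb X (fun n => all (P n) (ldec (w n))).
Proof.
move=> cw cP; apply: (@eq_recb X (fun n => all
  (fun i => P n (nth 0 (ldec (w n)) i)) (iota 0 (size (ldec (w n)))))) => [n|].
  by rewrite -all_nth_iota.
apply: recb_all_iota; first exact: recf_size.
apply: (@eq_recf X (fun z => (fun z => P (nfst z) (nsnd z) : nat)
  (npair (nfst z) (nth 0 (ldec (w (nfst z))) (nsnd z))))) => [z|].
  by rewrite npairK1 npairK2.
apply: (recf_comp cP); apply: recf_pair; first exact/recf_fst/recf_id.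
apply: recf_nth; last exact/recf_snd/recf_id.
by apply: recf_comp => //; apply/recf_fst/recf_id.
Qed.

Lemma recb_has (P : nat -> nat -> bool) w :
  recf X w -> recb X (fun z => P (nfst z) (nsnd z)) ->
  recb X (fun n => has (P n) (ldec (w n))).
Proof.
move=> cw cP; apply: (@eq_recb X
  (fun n => ~~ all (fun j => ~~ P n j) (ldec (w n)))) => [n|].
  by rewrite all_predC negbK.
by apply: recb_not; apply: recb_all => //; apply: recb_not.
Qed.

Lemma recb_mem a w :
  recf X a -> recf X w -> recb X (fun n => a n \in ldec (w n)).
Proof.
move=> ca cw; apply: (@eq_recb X (fun n => has (fun y => y == a n) (ldec (w n)))).
  by move=> n; rewrite has_pred1.
apply: recb_has => //; apply: recb_eq; first exact/recf_snd/recf_id.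
by apply: recf_comp => //; apply/recf_fst/recf_id.
Qed.

Lemma recf_half f : recf X f -> recf X (fun n => (f n)./2).
Proof.
move=> cf; apply: (@recf_mu X (fun n h => f n <= (h + h).+1)).
- apply: recb_leq; first by apply: recf_comp => //; apply/recf_fst/recf_id.
  by apply/recf_succ/recf_add; apply/recf_snd/recf_id.
- by move=> n; rewrite addnn; have := odd_double_half (f n); case: odd; lia.
- by move=> n h; rewrite addnn; have := odd_double_half (f n); case: odd; lia.
Qed.

Lemma recb_odd f : recf X f -> recb X (fun n => odd (f n)).
Proof.
move=> cf; apply: (@eq_recb X (fun n => f n == ((f n)./2 + (f n)./2).+1)).
  move=> n; rewrite addnn; have := odd_double_half (f n).
  by case: odd => /=; case: eqP => //=; lia.
by apply: recb_eq => //; apply/recf_succ/recf_add; apply: recf_half.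
Qed.

End ListClosure.

Lemma recf_comp2 X (F : nat -> nat -> nat) (a b : nat -> nat) :
  recf X (fun z => F (nfst z) (nsnd z)) -> recf X a -> recf X b ->
  recf X (fun n => F (a n) (b n)).
Proof.
move=> cF ca cb; apply: (@eq_recf X (fun n => (fun z => F (nfst z) (nsnd z))
  (npair (a n) (b n)))) => [n|]; first by rewrite npairK1 npairK2.
by apply: (recf_comp cF); apply: recf_pair.
Qed.

Lemma recb_comp2 X (Q : nat -> nat -> bool) (a b : nat -> nat) :
  recb X (fun z => Q (nfst z) (nsnd z)) -> recf X a -> recf X b ->
  recb X (fun n => Q (a n) (b n)).
Proof. exact: (@recf_comp2 X (fun i j => Q i j)). Qed.

Ltac rec_step :=
  cbv beta;
  match goal with
  | |- recf _ (fun n => n) => exact: recf_id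
  | |- recf _ (fun _ => ?a) => exact: recf_cst
  | H : recf ?X ?f |- recf ?X ?f => exact: H
  | H : recf ?X ?f |- recf ?X (fun n => ?f _) => apply: (recf_comp H)
  | |- recf _ (fun n => nfst _) => apply: recf_fst
  | |- recf _ (fun n => nsnd _) => apply: recf_snd
  | |- recf _ nfst => apply: (recf_fst (@recf_id _))
  | |- recf _ nsnd => apply: (recf_snd (@recf_id _))
  | |- recf _ (fun n => npair _ _) => apply: recf_pair
  | |- recf _ (fun n => nth 0 (ldec _) _) => apply: recf_nth
  | |- recf _ (fun n => size (ldec _)) => apply: recf_size
  | |- recf _ (fun n => _./2) => apply: recf_half
  | |- recf _ (fun n => _.-1) => apply: recf_pred
  | |- recf _ (fun n => _ + _) => apply: recf_add
  | |- recf _ (fun n => _ - _) => apply: recf_sub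
  | |- recf _ (fun n => _.+1) => apply: recf_succ
  | |- recf _ (fun n => if _ then _ else _) => apply: recf_if
  | |- recf _ (fun n => nat_of_bool (odd _)) => apply: recb_odd
  | |- recf _ (fun n => nat_of_bool (_ && _)) => apply: recb_and
  | |- recf _ (fun n => nat_of_bool (_ || _)) => apply: recb_or
  | |- recf _ (fun n => nat_of_bool (_ ==> _)) => apply: recb_imp
  | |- recf _ (fun n => nat_of_bool (~~ _)) => apply: recb_not
  | |- recf _ (fun n => nat_of_bool (if _ then _ else _)) => apply: recb_if
  | |- recf _ (fun n => nat_of_bool (_ <= _)) => apply: recb_leq
  | |- recf _ (fun n => nat_of_bool (_ == _)) =>
      first [apply: recb_eq | apply: recb_eqb]
  | |- recf _ (fun n => nat_of_bool (all _ (iota 0 _))) => apply: recb_all_iota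
  | |- recf _ (fun n => nat_of_bool (has _ (iota 0 _))) => apply: recb_has_iota
  | |- recf _ (fun n => nat_of_bool (all _ (ldec _))) => apply: recb_all
  | |- recf _ (fun n => nat_of_bool (has _ (ldec _))) => apply: recb_has
  | |- recf _ (fun n => nat_of_bool (_ \in ldec _)) => apply: recb_mem
  | H : recf ?X (fun z => nat_of_bool (?Q (nfst z) (nsnd z)))
    |- recf ?X (fun n => nat_of_bool (?Q _ _)) => apply: (recb_comp2 H)
  end.
Ltac recs := repeat rec_step.

Definition const_code (n : nat) : code := iter n (Comp Succ) Zero.

Lemma eval_const_code X n k : eval X (const_code n) k n.
Proof. by elim: n => //= n IHn; exists n. Qed.

(* Sigma_1 questions to [X] are questions to its jump: a constant argument is
   hard-wired into the program of an unbounded search, so that no s-m-n theorem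
   is needed. *)
Lemma recb_jump_exists X (Q : nat -> nat -> bool) :
  recb X (fun z => Q (nfst z) (nsnd z)) ->
  recb (jump X) (fun n => `[< exists y, Q n y >]).
Proof.
move=> cQ.
have [d dP] : recb X (fun z => ~~ Q (nfst z) (nsnd z)) by recs.
(* Each [num n] numbers a program that ignores its input, so running it on its own number, as the
   jump does, performs the intended search. Written as an iteration on numbers, [num] is
   computable. *)
pose num n := npair 6 (npair (code_num (Mu d))
  (iter n (fun w => npair 6 (npair (code_num Succ) w)) (code_num Zero))).
have numE n : num n = code_num (Comp (Mu d) (const_code n)).
  rewrite /num /=; congr (npair _ (npair _ _)).
  by elim: n => //= n ->.
apply: (@eq_recb _ (fun n => num n \in jump X)) => [n|].
  apply/idP/asboolP => [|[y Qy]].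
    rewrite inE => -[m [c]]; rewrite {1}numE => /code_num_inj -> /= [a an [da _]].
    exists m; move: da; have -> := eval_fun an (eval_const_code X n (num n)).
    move=> da; have := eval_fun da (dP (npair n m)).
    by rewrite npairK1 npairK2; case: (Q n m).
  rewrite inE; case: (@ex_minnP (Q n)) => [|m Qm mmin]; first by exists y.
  exists m; exists (Comp (Mu d) (const_code n)) => //=.
  exists n; first exact: eval_const_code; split=> [|j jm].
    by have := dP (npair n m); rewrite npairK1 npairK2 Qm.
  exists 0; have := dP (npair n j); rewrite npairK1 npairK2.
  by case Qj: (Q n j) => //; have := mmin _ Qj; rewrite leqNgt jm.
apply: recf_oracle; rewrite /num; recs.
apply: (@recf_iter _ (fun _ w => npair 6 (npair (code_num Succ) w))); recs.
Qed.

(** * Finite computations *)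

Definition triple (e n m : nat) : nat := npair e (npair n m).

(* A finite list of triples <e, n, m>, each read as "the program numbered [e]
   sends [n] to [m]", is a computation when every entry is justified by other
   entries. No well-foundedness is demanded: entries only appeal to proper
   subprograms, or to the previous stage of the same recursion. *)
Definition justified (O : nat -> nat -> bool) (L : seq nat) (z : nat) : bool :=
  let e := nfst z in let n := nfst (nsnd z) in let m := nsnd (nsnd z) in
  let k := nfst e in let f := nfst (nsnd e) in let g := nsnd (nsnd e) in
  [|| (e == npair 0 0) && (m == 0),
      (e == npair 1 0) && (m == n.+1),
      (e == npair 2 0) && (m == nfst n),
      (e == npair 3 0) && (m == nsnd n),
      (e == npair 4 0) && O n m,
      [&& k == 5, triple f n (nfst m) \in L & triple g n (nsnd m) \in L],
      (k == 6) && has (fun y => [&& nfst y == g, nfst (nsnd y) == n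
                                  & triple f (nsnd (nsnd y)) m \in L]) L,
      (k == 7) &&
        (if nsnd n == 0 then triple f (nfst n) m \in L else
         has (fun y => [&& nfst y == e,
                nfst (nsnd y) == npair (nfst n) (nsnd n).-1
              & triple g (npair (nfst n)
                  (npair (nsnd n).-1 (nsnd (nsnd y)))) m \in L]) L)
    | [&& k == 8, triple (nsnd e) (npair n m) 0 \in L
        & all (fun j => has (fun y => [&& nfst y == nsnd e,
                nfst (nsnd y) == npair n j & nsnd (nsnd y) != 0]) L)
              (iota 0 m)]].

Lemma recb_justified X (O : nat -> nat -> nat -> bool) a w z :
  recb X (fun y => O (nfst y) (nfst (nsnd y)) (nsnd (nsnd y))) ->
  recf X a -> recf X w -> recf X z ->
  recb X (fun n => justified (O (a n)) (ldec (w n)) (z n)).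
Proof.
move=> cO ca cw cz; rewrite /justified /triple.
have cO3 b c d : recf X b -> recf X c -> recf X d ->
    recb X (fun n => O (b n) (c n) (d n)).
  move=> cb cc cd; apply: (@eq_recb X (fun n =>
    (fun y => O (nfst y) (nfst (nsnd y)) (nsnd (nsnd y)))
    (npair (b n) (npair (c n) (d n))))) => [n|].
    by rewrite !npairK1 !npairK2 npairK1.
  by apply: (recf_comp cO); recs.
by recs; apply: (cO3 a (fun n => nfst (nsnd (z n)))
                        (fun n => nsnd (nsnd (z n)))); recs.
Qed.

(** Membership in the list occurs only positively in every clause. *)
Lemma justified_sub O (L L' : seq nat) z :
  {subset L <= L'} -> justified O L z -> justified O L' z.
Proof.
move=> sub; rewrite /justified.
have memS x : x \in L -> x \in L' by apply: sub.
have hasS (P P' : pred nat) : subpred P P' -> has P L -> has P' L'.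
  by move=> PP' /hasP[x xL Px]; apply/hasP; exists x; [apply: sub|apply: PP'].
have orS (a a' b b' : bool) : (a -> a') -> (b -> b') -> a || b -> a' || b'.
  by move=> aa' bb' /orP[/aa' ->|/bb' ->]; rewrite ?orbT.
have andS (a a' b b' : bool) : (a -> a') -> (b -> b') -> a && b -> a' && b'.
  by move=> aa' bb' /andP[/aa' -> /bb' ->].
do 5!apply: (orS) => //; apply: (orS).
  by apply: (andS) => //; apply: (andS); apply: memS.
apply: (orS).
  apply: (andS) => //; apply: (hasS) => y; do 2!apply: (andS) => //.
  exact: memS.
apply: (orS).
  apply: (andS) => //; case: ifP => [_|_]; first exact: memS.
  by apply: (hasS) => y; do 2!apply: (andS) => //; apply: memS.
apply: (andS) => //; apply: (andS); first exact: memS.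
by apply: sub_all => j; apply: (hasS).
Qed.

(** Only entries of the program [Oracle] consult [O]. This carries computations from one condition
    or stage to another. *)
Lemma eq_justified (O O' : nat -> nat -> bool) L z :
  (nfst z = npair 4 0 -> O (nfst (nsnd z)) (nsnd (nsnd z)) ->
     O' (nfst (nsnd z)) (nsnd (nsnd z))) ->
  justified O L z -> justified O' L z.
Proof.
move=> OO'; rewrite /justified.
have [e4|//] := eqVneq (nfst z) (npair 4 0); have {}OO' := OO' e4.
move: OO'; case: (O _ _); case: (O' _ _) => //=; first by move/(_ isT).
move=> _ _.
by rewrite /= !orbT.
Qed.

Definition computation O L := all (justified O L) L.

Lemma recb_computation X (O : nat -> nat -> nat -> bool) a w :
  recb X (fun y => O (nfst y) (nfst (nsnd y)) (nsnd (nsnd y))) ->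
  recf X a -> recf X w ->
  recb X (fun n => computation (O (a n)) (ldec (w n))).
Proof.
move=> cO ca cw; rewrite /computation; recs.
by apply: (@recb_justified X O (fun z => a (nfst z)) (fun z => w (nfst z)) nsnd);
  recs.
Qed.

Lemma computation_cat O L L' :
  computation O L -> computation O L' -> computation O (L ++ L').
Proof.
move=> /allP cL /allP cL'; apply/allP => z; rewrite mem_cat.
by case/orP => [/cL|/cL']; apply: justified_sub => x; rewrite mem_cat => ->;
  rewrite ?orbT.
Qed.

Lemma computation_cons O L z :
  computation O L -> justified O L z -> computation O (z :: L).
Proof.
move=> /allP cL jz; apply/allP => x; rewrite in_cons.
have sub : {subset L <= z :: L} by move=> y; rewrite in_cons orbC => ->.
by case/orP => [/eqP ->|/cL]; [move: jz|]; apply: justified_sub.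
Qed.

(** Induction on the program, with an inner induction on the stage for [Rec], whose entries appeal
    to the same program. *)
Lemma computation_sound X (O : nat -> nat -> bool) L c n m :
  (forall i k, triple (code_num Oracle) i k \in L -> O i k -> k = (i \in X)) ->
  computation O L -> triple (code_num c) n m \in L -> eval X c n m.
Proof.
move=> OX /allP cL.
elim: c n m => [||||| f IHf g IHg | f IHf g IHg | f IHf g IHg | f IHf] n m
  /[dup] zL /cL; rewrite /justified /triple /= !(npairK1, npairK2, npair_eq) /=
  ?(andbF, orbF, andbT).
- by move/eqP.
- by move/eqP.
- by move/eqP.
- by move/eqP.
- exact: OX zL.
- move=> /andP[/IHf ff /IHg gg]; exists (nfst m), (nsnd m); split=> //.
  by rewrite npairK.
- case/hasP => y yL /and3P[/eqP yg /eqP yn /IHf fm].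
  exists (nsnd (nsnd y)) => //; apply: IHg.
  by rewrite -yg -yn /triple !npairK.
- move=> _; rewrite -[n]npairK in zL.
  move: (nfst n) (nsnd n) m zL => a j; elim: j => [|j IHj] m /[dup] zL /cL.
    rewrite /justified /triple /= !(npairK1, npairK2, npair_eq) /= ?(andbF, orbF).
    by move/IHf => fm; exists (fun=> m).
  rewrite /justified /triple /= !(npairK1, npairK2, npair_eq) /= ?(andbF, orbF).
  case/hasP => y yL /and3P[/eqP ye /eqP yn /IHg gm].
  case: (IHj (nsnd (nsnd y))) => [|h [h0 hS hj]].
    by rewrite (_ : triple _ _ _ = y) // /triple /= -yn -ye !npairK.
  exists (fun i => if i <= j then h i else m); split=> //; last by rewrite ltnn.
  move=> i; rewrite ltnS => ij; rewrite ij.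
  move: ij; rewrite leq_eqVlt => /orP[/eqP ->|ij]; first by rewrite ltnn -hj.
  by rewrite ij; apply: hS.
- case/andP => /IHf f0 /allP fS; split=> // j jm.
  have /fS/hasP[y yL /and3P[/eqP yf /eqP yj y0]] : j \in iota 0 m.
    by rewrite mem_iota.
  exists (nsnd (nsnd y)).-1; rewrite prednK ?lt0n //; apply: IHf.
  by rewrite -yf -yj /triple !npairK.
Qed.

Definition answer (X : set nat) (n m : nat) : bool := m == (n \in X).

(** Induction on the program: lists for the subcomputations are concatenated, which preserves
    justifications, and the new entry is put in front. *)
Lemma computation_complete X c n m : eval X c n m ->
  exists2 L, triple (code_num c) n m \in L & computation (answer X) L.
Proof.
pose A := answer X.
have extend L z : computation A L -> justified A L z ->
    exists2 L', z \in L' & computation A L'.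
  move=> cL jz; exists (z :: L); first exact: mem_head.
  exact: computation_cons.
have leaf z : justified A [::] z -> exists2 L', z \in L' & computation A L'.
  exact: extend.
elim: c n m => [||||| f IHf g IHg | f IHf g IHg | f IHf g IHg | f IHf] n m /=.
- by move=> ->; apply: leaf; rewrite /justified /triple !(npairK1, npairK2) !eqxx.
- move=> ->; apply: leaf; rewrite /justified /triple.
  by rewrite !(npairK1, npairK2) !eqxx !orbT.
- move=> ->; apply: leaf; rewrite /justified /triple.
  by rewrite !(npairK1, npairK2) !eqxx !orbT.
- move=> ->; apply: leaf; rewrite /justified /triple.
  by rewrite !(npairK1, npairK2) !eqxx !orbT.
- move=> ->; apply: leaf; rewrite /justified /triple /A /answer.
  by rewrite !(npairK1, npairK2) !eqxx !orbT.
- move=> [a [b [/IHf [L1 L1a cL1] /IHg [L2 L2b cL2] ->]]].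
  apply: (extend (L1 ++ L2)); first exact: computation_cat.
  rewrite /justified /triple !(npairK1, npairK2) !mem_cat L1a L2b.
  by rewrite !eqxx !orbT.
- move=> [a /IHg [L2 L2b cL2] /IHf [L1 L1a cL1]].
  apply: (extend (L1 ++ L2)); first exact: computation_cat.
  rewrite /justified /triple !(npairK1, npairK2).
  set h := has _ (L1 ++ L2); have -> : h; last by rewrite eqxx !orbT.
  apply/hasP; exists (triple (code_num g) n a); first by rewrite mem_cat L2b orbT.
  by rewrite /triple !(npairK1, npairK2) !eqxx mem_cat L1a.
- move=> [h [h0 hS ->]]; rewrite -[n in triple _ n]npairK.
  move: (nfst n) (nsnd n) h0 hS => a j h0; elim: j => [_|j IHj hS].
    have [L La cL] := IHf _ _ h0; apply: (extend _ _ cL).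
    by rewrite /justified /triple !(npairK1, npairK2) La !eqxx !orbT.
  have [|L1 L1a cL1] := IHj; first by move=> i ij; apply/hS/ltnW.
  have [L2 L2b cL2] := IHg _ _ (hS j (ltnSn j)).
  apply: (extend (L1 ++ L2)); first exact: computation_cat.
  rewrite /justified /triple !(npairK1, npairK2) /=.
  set b := has _ (L1 ++ L2); have -> : b; last by rewrite /= !orbT.
  apply/hasP; exists (triple (code_num (Rec f g)) (npair a j) (h j)).
    by rewrite mem_cat L1a.
  by rewrite /triple !(npairK1, npairK2) !eqxx mem_cat L2b orbT.
- move=> [/IHf [L0 L0m cL0] below].
  have [L1 [cL1 L1P]] : exists L, computation A L /\ forall j, j < m ->
      exists v, triple (code_num f) (npair n j) v.+1 \in L.
    elim: m below {L0m} => [|k IHk] below; first by exists [::].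
    have [|L1 [cL1 L1P]] := IHk; first by move=> j jk; apply/below/ltnW.
    have [v /IHf [L2 L2v cL2]] := below k (ltnSn k).
    exists (L1 ++ L2); split; first exact: computation_cat.
    move=> j; rewrite ltnS leq_eqVlt => /orP[/eqP ->|/L1P [u uL]].
      by exists v; rewrite mem_cat L2v orbT.
    by exists u; rewrite mem_cat uL.
  apply: (extend (L0 ++ L1)); first exact: computation_cat.
  rewrite /justified /triple !(npairK1, npairK2) !mem_cat L0m.
  set b := all _ (iota 0 m); have -> : b; last by rewrite !eqxx !orbT.
  apply/allP => j; rewrite mem_iota => /= /L1P [v vL].
  apply/hasP; exists (triple (code_num f) (npair n j) v.+1).
    by rewrite mem_cat vL orbT.
  by rewrite /triple !(npairK1, npairK2) !eqxx.
Qed.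

(** * The forcing *)

(** A form with only bounded quantifiers over positions, hence computable on codes. *)
Lemma prefix_nthE (s t : seq bool) : prefix s t =
  (size s <= size t) && all (fun x => nth false s x == nth false t x)
                            (iota 0 (size s)).
Proof.
apply/prefixP/andP => [[u ->]|[st /allP eq_st]].
  rewrite size_cat leq_addr; split=> //; apply/allP => x; rewrite mem_iota /=.
  by move=> xs; rewrite nth_cat xs.
exists (drop (size s) t); rewrite -{1}(cat_take_drop (size s) t); congr (_ ++ _).
apply: (@eq_from_nth _ false) => [|x]; rewrite size_takel // => xs.
by rewrite nth_take //; apply/esym/eqP/eq_st; rewrite mem_iota.
Qed.

Lemma prefix_nth (s t : seq bool) x :
  prefix s t -> x < size s -> nth false t x = nth false s x.
Proof.
rewrite prefix_nthE => /andP[_ /allP h] xs; apply/esym/eqP/h.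
by rewrite mem_iota.
Qed.

(* [lock] alone is the one of ssreflect. *)
Local Notation lock := Defs.lock.

(** The side of column [i] on which new elements of the cohesive set must lie: an unlocked column is
    avoided, like one locked to 0. *)
Definition side (p : condition) (i : nat) : bool := lock p i == Some true.

Lemma extends_refl p : extends p p.
Proof.
split=> // i ip; split=> //; first exact: prefix_refl.
by move=> b _ x /andP[px]; rewrite ltnNge px.
Qed.

Lemma extends_trans q p r : extends r q -> extends q p -> extends r p.
Proof.
move=> [qr rqP] [pq qpP]; split; first exact: leq_trans pq qr.
move=> i ip; have [lq sq fq] := qpP i ip.
have [lr sr fr] := rqP i (leq_trans ip pq); split; first by rewrite lr.
  exact: prefix_trans sq sr.
move=> b pb x /andP[px xr]; have [xq|qx] := ltnP x (size (str q i)).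
  by rewrite (prefix_nth sr xq); apply: fq; rewrite ?px.
by apply: fr; rewrite ?lq ?qx.
Qed.

(* Pairs (t, p) of a condition [p] for the generic sequence and an initial
   segment [t] of the cohesive set. From now on, every new element of the set
   has to leave the unlocked columns of [p], and to follow the locked ones. *)
Definition mathias_extends (t' : seq bool) (p' : condition)
    (t : seq bool) (p : condition) : Prop :=
  [/\ prefix t t', extends p' p
    & forall x i, size t <= x < size t' -> nth false t' x -> i < size p ->
        x < size (str p' i) /\ nth false (str p' i) x = side p i].

Lemma mathias_extends_refl t p : mathias_extends t p t p.
Proof.
split; [exact: prefix_refl|exact: extends_refl|] => x i /andP[tx].
by rewrite ltnNge tx.
Qed.

Lemma mathias_extends_trans t1 p1 t2 p2 t3 p3 :
  mathias_extends t3 p3 t2 p2 -> mathias_extends t2 p2 t1 p1 ->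
  mathias_extends t3 p3 t1 p1.
Proof.
move=> [t23 p23 h23] [t12 p12 h12]; split.
- exact: prefix_trans t12 t23.
- exact: extends_trans p23 p12.
move=> x i /andP[t1x xt3] t3x ip1; have [p12s p12P] := p12.
have [lock12 _ _] := p12P i ip1; have ip2 := leq_trans ip1 p12s.
(* If [x] lies beyond [t2], it obeys [p2], which has the locks of [p1] on the columns of [p1].
   Otherwise its bits were already fixed in [p2] and persist in [p3]. *)
have [xt2|t2x] := ltnP x (size t2); last first.
  by rewrite /side -lock12; apply: h23; rewrite ?t2x.
have [||//|xs2 <-] := h12 x i; [by rewrite t1x | by rewrite -(prefix_nth t23) |].
have [_ pre _] := p23.2 i ip2; split; last exact: prefix_nth pre xs2.
exact: leq_trans xs2 (size_prefix pre).
Qed.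

(** * Conditions coded by numbers, with a decidable extension relation *)

Definition bits (w : nat) : seq bool := [seq a != 0 | a <- ldec w].
(** Every number decodes to a lock, so searches over pairs become searches over all numbers. The
    default 0 of [nth] decodes to an empty unlocked column. *)
Definition lock_of (k : nat) : option bool :=
  if k == 0 then None else Some (k == 1).
Definition column (q i : nat) : nat := nth 0 (ldec (nsnd q)) i.
Definition stem (q : nat) : seq bool := bits (nfst q).
Definition cond (q : nat) : condition :=
  [seq (bits (nsnd z), lock_of (nfst z)) | z <- ldec (nsnd q)].

Lemma size_bits w : size (bits w) = size (ldec w).
Proof. by rewrite size_map. Qed.

Lemma nth_bits w x : nth false (bits w) x = (nth 0 (ldec w) x != 0).
Proof.
have [xw|wx] := ltnP x (size (ldec w)); first by rewrite (nth_map 0).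
by rewrite !nth_default ?size_bits.
Qed.

Lemma size_cond q : size (cond q) = size (ldec (nsnd q)).
Proof. by rewrite size_map. Qed.

Lemma nth_cond q i : nth ([::], None) (cond q) i =
  (bits (nsnd (column q i)), lock_of (nfst (column q i))).
Proof.
have [iq|qi] := ltnP i (size (ldec (nsnd q))).
  by rewrite (nth_map 0) -/(column q i).
rewrite nth_default ?size_cond // /column nth_default //.
Qed.

Lemma str_cond q i : str (cond q) i = bits (nsnd (column q i)).
Proof. by rewrite /str nth_cond. Qed.

Lemma lock_cond q i : lock (cond q) i = lock_of (nfst (column q i)).
Proof. by rewrite /lock nth_cond. Qed.

Lemma lock_of_eq a b :
  (lock_of a == lock_of b) = ((a == 0) == (b == 0)) && ((a == 1) == (b == 1)).
Proof. by case: a b => [|[|a]] [|[|b]]. Qed.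

Lemma side_cond q i : side (cond q) i = (nfst (column q i) == 1).
Proof. by rewrite /side lock_cond; case: (nfst _) => [|[|]]. Qed.

Lemma condition_number t p : exists q, stem q = t /\ cond q = p.
Proof.
have bits_surj s : bits (lcode (map nat_of_bool s)) = s.
  by rewrite /bits lcodeK -map_comp map_id_in // => -[].
pose enc (o : option bool) := if o is Some b then if b then 1 else 2 else 0.
exists (npair (lcode (map nat_of_bool t)) (lcode
  [seq npair (enc c.2) (lcode (map nat_of_bool c.1)) | c <- p])).
rewrite /stem /cond npairK1 npairK2 bits_surj lcodeK -map_comp; split=> //.
rewrite map_id_in // => -[s l] _ /=; rewrite npairK1 npairK2 bits_surj.
by case: l => [[]|].
Qed.

Definition ext (r q : nat) : bool :=
  `[< mathias_extends (stem r) (cond r) (stem q) (cond q) >].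

Lemma ext_refl q : ext q q.
Proof. exact/asboolP/mathias_extends_refl. Qed.

Lemma ext_trans p q r : ext r q -> ext q p -> ext r p.
Proof.
move=> /asboolP rq /asboolP qp; apply/asboolP.
exact: mathias_extends_trans rq qp.
Qed.

Definition prefix_num (v w : nat) : bool := (size (ldec v) <= size (ldec w)) &&
  all (fun x => (nth 0 (ldec v) x != 0) == (nth 0 (ldec w) x != 0))
      (iota 0 (size (ldec v))).

Lemma prefix_bits v w : prefix (bits v) (bits w) = prefix_num v w.
Proof.
rewrite prefix_nthE !size_bits; congr (_ && _).
by apply: eq_all => x; rewrite !nth_bits.
Qed.

Definition ext_num (r q : nat) : bool :=
  [&& prefix_num (nfst q) (nfst r),
      size (ldec (nsnd q)) <= size (ldec (nsnd r)),
      all (fun i =>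
        [&& (nfst (column r i) == 0) == (nfst (column q i) == 0),
            (nfst (column r i) == 1) == (nfst (column q i) == 1),
            prefix_num (nsnd (column q i)) (nsnd (column r i))
          & (nfst (column q i) != 0) ==>
            all (fun x => (size (ldec (nsnd (column q i))) <= x) ==>
                  ((nth 0 (ldec (nsnd (column r i))) x != 0) ==
                   (nfst (column q i) == 1)))
              (iota 0 (size (ldec (nsnd (column r i)))))])
        (iota 0 (size (ldec (nsnd q))))
    & all (fun x => (size (ldec (nfst q)) <= x) &&
            (nth 0 (ldec (nfst r)) x != 0) ==>
          all (fun i => (x.+1 <= size (ldec (nsnd (column r i)))) &&
              ((nth 0 (ldec (nsnd (column r i))) x != 0) ==
               (nfst (column q i) == 1)))
            (iota 0 (size (ldec (nsnd q)))))
        (iota 0 (size (ldec (nfst r))))].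

(** The clauses inspect only columns and positions of two finite objects, so bounded quantifiers
    suffice and the relation is computable. *)
Lemma extE r q : ext r q = ext_num r q.
Proof.
apply/asboolP/and4P => [[pre [ss h] grow]|[pre ss /allP h /allP grow]].
  split; rewrite -?prefix_bits -?(size_cond q) -?(size_cond r) //.
    apply/allP => i; rewrite mem_iota add0n => iq.
    have [lk pr fill] := h i iq; rewrite andbA -lock_of_eq -!lock_cond lk eqxx /=.
    rewrite -prefix_bits -!str_cond pr /=; apply/implyP => q0; apply/allP => x.
    rewrite mem_iota add0n -!size_bits -nth_bits -!str_cond -side_cond => xr.
    apply/implyP => qx; apply/eqP.
    apply: fill; last by rewrite qx.
    by rewrite lock_cond /lock_of (negbTE q0) side_cond.
  apply/allP => x; rewrite mem_iota add0n -!size_bits -nth_bits => xr.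
  apply/implyP => /andP[qx rx].
  apply/allP => i; rewrite mem_iota add0n -size_bits -nth_bits -str_cond -side_cond.
  by move=> iq; have [||| -> ->] := grow x i; rewrite ?qx ?eqxx.
split.
- by rewrite prefix_bits.
- rewrite /extends !size_cond; split=> // i iq.
  have /h/and4P[h0 h1 hp hf] : i \in iota 0 (size (ldec (nsnd q))).
    by rewrite mem_iota.
  have lk : lock (cond r) i = lock (cond q) i.
    by apply/eqP; rewrite !lock_cond lock_of_eq h0.
  rewrite !str_cond; split=> //; first by rewrite prefix_bits.
  move=> b; rewrite lock_cond /lock_of; case: ifP hf => //= _ /allP hf [<-] x.
  rewrite !size_bits nth_bits => /andP[qx xr].
  suff /hf/implyP/(_ qx)/eqP : x \in iota 0 (size (ldec (nsnd (column r i)))).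
    by [].
  by rewrite mem_iota.
- move=> x i; rewrite !size_bits nth_bits size_cond => /andP[qx xr] rx iq.
  have /grow : x \in iota 0 (size (ldec (nfst r))) by rewrite mem_iota.
  rewrite qx rx => /allP/(_ i); rewrite mem_iota => /(_ iq) /andP[xi /eqP xE].
  by rewrite str_cond size_bits nth_bits side_cond.
Qed.

Lemma recb_ext X a b :
  recf X a -> recf X b -> recb X (fun n => ext (a n) (b n)).
Proof.
move=> ca cb; apply: (@eq_recb X (fun n => ext_num (a n) (b n))) => [n|].
  by rewrite extE.
by rewrite /ext_num /prefix_num /column; recs.
Qed.

(** The pair [q] settles bit [n] of the join of the sequence and the cohesive set: odd [n] read the
    stem, even [n] a bit of a column, following [join] and [seq_set]. Bits not yet reached have no
    value. *)
Definition fact (q n m : nat) : bool :=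
  let h := n./2 in
  if odd n then (h < size (stem q)) && (m == nth false (stem q) h)
  else [&& nfst h < size (cond q), nsnd h < size (str (cond q) (nfst h))
         & m == nth false (str (cond q) (nfst h)) (nsnd h)].

Lemma recb_fact X a b c : recf X a -> recf X b -> recf X c ->
  recb X (fun n => fact (a n) (b n) (c n)).
Proof.
move=> ca cb cc; apply: (@eq_recb X (fun n =>
  if odd (b n) then ((b n)./2.+1 <= size (ldec (nfst (a n)))) &&
    (c n == if nth 0 (ldec (nfst (a n))) (b n)./2 == 0 then 0 else 1)
  else [&& (nfst (b n)./2).+1 <= size (ldec (nsnd (a n))),
      (nsnd (b n)./2).+1 <=
        size (ldec (nsnd (nth 0 (ldec (nsnd (a n))) (nfst (b n)./2))))
    & c n == if nth 0 (ldec (nsnd (nth 0 (ldec (nsnd (a n))) (nfst (b n)./2))))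
                    (nsnd (b n)./2) == 0 then 0 else 1])) => [n|].
  rewrite /fact !str_cond !size_bits size_cond !nth_bits.
  have bE k : (if k == 0 then 0 else 1) = (k != 0) :> nat by case: k.
  by rewrite /column !bE.
by recs.
Qed.

Lemma fact_ext r q n m : ext r q -> fact q n m -> fact r n m.
Proof.
move=> /asboolP[st [ss cP] _]; rewrite /fact; case: ifP => _.
  move=> /andP[hq /eqP ->]; rewrite (prefix_nth st hq) eqxx andbT.
  exact: leq_trans hq (size_prefix st).
move=> /and3P[iq xq /eqP ->]; have [_ pre _] := cP _ iq.
rewrite (prefix_nth pre xq) eqxx (leq_trans iq ss) /= andbT.
exact: leq_trans xq (size_prefix pre).
Qed.

(** * The diagonalizing sequence *)

(** [phi] is undefined at numbers that are not Goedel numbers. A list closed under passing to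
    subprograms certifies that its members are Goedel numbers. *)
Definition code_entry (K : seq nat) (e : nat) : bool :=
  [|| (nfst e <= 4) && (nsnd e == 0),
      [&& 5 <= nfst e, nfst e <= 7, nfst (nsnd e) \in K & nsnd (nsnd e) \in K]
    | (nfst e == 8) && (nsnd e \in K)].

Definition code_list (K : seq nat) : bool := all (code_entry K) K.

(** Compound programs have tag at least 5, so by [leq_npair] their subprograms have smaller numbers
    and strong induction applies. *)
Lemma code_list_sound K e :
  code_list K -> e \in K -> exists c, code_num c = e.
Proof.
move=> /allP cK; elim/ltn_ind: e => e IHe /cK; rewrite /code_entry.
have e_split := npairK e; have e_leq := leq_npair (nfst e) (nsnd e).
rewrite e_split in e_leq.
case/or3P => [/andP[e4 /eqP e0]|/and4P[e5 e7 fK gK]|/andP[/eqP e8 fK]].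
- rewrite -e_split e0; move: (nfst e) e4 => [|[|[|[|[|]]]]] // _.
  + by exists Zero.
  + by exists Succ.
  + by exists Fst.
  + by exists Snd.
  + by exists Oracle.
- have := leq_npair (nfst (nsnd e)) (nsnd (nsnd e)); rewrite npairK => fg.
  have [|f fE] := IHe _ _ fK; first by lia.
  have [|g gE] := IHe _ _ gK; first by lia.
  rewrite -e_split -(npairK (nsnd e)) -fE -gE.
  have : [|| nfst e == 5, nfst e == 6 | nfst e == 7] by lia.
  case/or3P => /eqP ->; by [exists (Pair f g)|exists (Comp f g)|exists (Rec f g)].
- have [|f fE] := IHe _ _ fK; first by lia.
  by rewrite -e_split e8 -fE; exists (Mu f).
Qed.

Lemma code_list_complete c : exists2 K, code_num c \in K & code_list K.
Proof.
have ok_sub (K K' : seq nat) e :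
    {subset K <= K'} -> code_entry K e -> code_entry K' e.
  rewrite /code_entry => sub.
  case/or3P => [->//|/and4P[e5 e7 /sub fK /sub gK]|/andP[e8 /sub fK]].
    by rewrite e5 e7 fK gK orbT.
  by rewrite e8 fK !orbT.
have ok_cons K e : code_list K -> code_entry K e ->
    exists2 K', e \in K' & code_list K'.
  move=> /allP cK oe; exists (e :: K); first exact: mem_head.
  have sub : {subset K <= e :: K} by move=> y; rewrite in_cons orbC => ->.
  apply/allP => x; rewrite in_cons => /orP[/eqP ->|/cK]; last exact: ok_sub.
  exact: ok_sub oe.
have ok_cat K K' : code_list K -> code_list K' -> code_list (K ++ K').
  move=> /allP cK /allP cK'; apply/allP => x; rewrite mem_cat.
  by case/orP => [/cK|/cK']; apply: ok_sub => y; rewrite mem_cat => ->;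
    rewrite ?orbT.
elim: c => [||||| f [K1 f1 c1] g [K2 g2 c2] | f [K1 f1 c1] g [K2 g2 c2]
  | f [K1 f1 c1] g [K2 g2 c2] | f [K1 f1 c1]];
  try (by apply: (ok_cons [::]); rewrite // /code_entry /= !(npairK1, npairK2));
  try (by apply: (ok_cons _ _ (ok_cat _ _ c1 c2));
       rewrite /code_entry /= !(npairK1, npairK2) !mem_cat f1 g2 !orbT).
by apply: (ok_cons _ _ c1); rewrite /code_entry /= !(npairK1, npairK2) f1.
Qed.

(* The condition numbered [q] makes the program numbered [n] halt on input [n],
   by a computation with number below [w]. *)
Definition converges (q w n : nat) : bool :=
  has (fun k => has (fun z => (nfst z == n) && (nfst (nsnd z) == n)) (ldec k) &&
                computation (fact q) (ldec k)) (iota 0 w) &&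
  has (fun k => (n \in ldec k) && code_list (ldec k)) (iota 0 w).

Lemma recb_converges X a b c : recf X a -> recf X b -> recf X c ->
  recb X (fun n => converges (a n) (b n) (c n)).
Proof.
move=> ca cb cc; rewrite /converges /code_list /code_entry; recs.
apply: (@recb_computation X fact (fun z => a (nfst z)) nsnd); recs.
by apply: recb_fact; recs.
Qed.

Lemma converges_leq q w w' n : w <= w' -> converges q w n -> converges q w' n.
Proof.
move=> ww' /andP[/hasP[k kw hk] /hasP[l lw hl]].
move: kw lw; rewrite !mem_iota !add0n => kw lw.
apply/andP; split; apply/hasP; [exists k => //|exists l => //];
  rewrite mem_iota add0n; lia.
Qed.

Lemma converges_ext r q w n : ext r q -> converges q w n -> converges r w n.
Proof.
rewrite /converges => rq /andP[/hasP[k kw /andP[hk /allP ck]] ->]; rewrite andbT.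
apply/hasP; exists k => //; rewrite hk; apply/allP => z /ck.
by apply: eq_justified => _; apply: fact_ext.
Qed.

(* The answer [m] to the question whether [n] lies in the jump, where
   [y = <x, <q, w>>]: a positive answer is witnessed below [w] in the condition
   [q]; a negative one is not refuted below [x] by an extension of [q]. *)
Definition jump_fact (y n m : nat) : bool :=
  let x := nfst y in let q := nfst (nsnd y) in let w := nsnd (nsnd y) in
  (m == 1) && converges q w n ||
  (m == 0) && all (fun r => ext r q ==> ~~ converges r x n) (iota 0 x).

(* [e = <c, p>] and [u = <q, <w, <v, l>>>]: up to stage [x], the list numbered
   [l] looks like a proof that the extension [q] of [p] forces the program [c],
   run with the jump as oracle, to send [e] to [v]. *)
Definition plausible (x e u : nat) : bool :=
  let q := nfst u in let w := nfst (nsnd u) in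
  let v := nfst (nsnd (nsnd u)) in let l := nsnd (nsnd (nsnd u)) in
  [&& ext q (nsnd e), triple (nfst e) e v \in ldec l
    & computation (jump_fact (npair x (npair q w))) (ldec l)].

Definition value (u : nat) : nat := nfst (nsnd (nsnd u)).

(* The least plausible [u] stabilizes as [x] grows, as soon as some [u] remains
   plausible forever; the limit then disagrees with the forced value. *)
Definition guess (e x : nat) : bool :=
  has (fun u => [&& plausible x e u, value u == 0
                  & all (fun u' => ~~ plausible x e u') (iota 0 u)]) (iota 0 x).

Lemma recb_plausible X a b c : recf X a -> recf X b -> recf X c ->
  recb X (fun n => plausible (a n) (b n) (c n)).
Proof.
move=> ca cb cc; rewrite /plausible /triple.
apply: recb_and; first by apply: recb_ext; recs.
apply: recb_and; first by recs.
apply: (@recb_computation X jump_fact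
  (fun n => npair (a n) (npair (nfst (c n)) (nfst (nsnd (c n)))))
  (fun n => nsnd (nsnd (nsnd (c n))))); [|by recs|by recs].
by rewrite /jump_fact; recs; try apply: recb_converges; try apply: recb_ext; recs.
Qed.

Lemma recb_guess X : recb X (fun z => guess (nfst z) (nsnd z)).
Proof.
by rewrite /guess /value; recs; apply: recb_plausible; recs.
Qed.

(** Positive answers do not depend on the stage, and negative ones face fewer attempted refutations
    at an earlier stage. *)
Lemma plausible_leq x x' e u : x <= x' -> plausible x' e u -> plausible x e u.
Proof.
move=> xx' /and3P[qe eu /allP cu]; apply/and3P; split=> //; apply/allP => z /cu.
apply: eq_justified => _; rewrite /jump_fact !npairK2 !npairK1.
case/orP => [->//|/andP[-> /allP h]]; apply/orP; right.
apply/allP => r; rewrite mem_iota add0n => rx.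
have /h : r \in iota 0 x' by rewrite mem_iota; lia.
case: ext => //=; apply: contra; exact: converges_leq.
Qed.

Lemma guess_limit e u : (forall x, plausible x e u) ->
  exists v t, (forall x, plausible x e v) /\
    forall x, t <= x -> guess e x = (value v == 0).
Proof.
move=> pu; pose P u := `[< forall x, plausible x e u >].
have [|v /asboolP pv vmin] := @ex_minnP P; first by exists u; apply/asboolP.
have [t tP] : exists t, forall u', u' < v -> ~~ plausible t e u'.
  elim: (v) vmin => [_|k IHk kmin]; first by exists 0.
  have [t tP] := IHk (fun n Pn => ltnW (kmin n Pn)).
  have [t' t'P] : exists t', ~~ plausible t' e k.
    apply: contrapT => /forallNP all_p; suff /kmin : P k by rewrite ltnn.
    by apply/asboolP => x; apply/negPn/negP/all_p.
  exists (maxn t t') => u'; rewrite ltnS leq_eqVlt => /orP[/eqP ->|/tP];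
    apply: contra t'P || apply: contra; apply: plausible_leq; lia.
(* From [t] on all smaller candidates are refuted; [v.+1] lets the bounded search in [guess] reach
   [v]. *)
exists v, (maxn t v.+1); split=> // x tx.
have small u' : u' < v -> ~~ plausible x e u'.
  by move=> /tP; apply: contra; apply: plausible_leq; lia.
apply/hasP/idP => [[w _ /and3P[pw w0 /allP wmin]]|v0].
  have : w = v; last by move=> <-.
  case: (ltngtP w v) => // [/small|wv]; first by rewrite pw.
  by have := wmin v; rewrite mem_iota /= pv => /(_ wv).
exists v; first by rewrite mem_iota; lia.
rewrite pv v0; apply/allP => u'; rewrite mem_iota; exact: small.
Qed.

(** * Requirements on pairs and their density *)

Definition decides (n p : nat) : Prop :=
  (exists w, converges p w n) \/ forall r w, ext r p -> ~~ converges r w n.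

(** Either [p] lies below a pair forcing a value that row [e] contradicts in the limit, or no value
    is ever forced below the pair stored in [e], to which [p] belongs. *)
Definition diagonalizes (c p : nat) : Prop :=
  exists2 e, nfst e = c &
  (exists u t, [/\ forall x, plausible x e u,
                   forall x, t <= x -> guess e x = (value u == 0)
                 & ext p (nfst u)]) \/
  (forall u, exists x, ~~ plausible x e u) /\ ext p (nsnd e).

Lemma decides_dense n p : exists2 r, ext r p & decides n r.
Proof.
have [[r [w [rp cr]]]|no] := pselect (exists r w, ext r p /\ converges r w n).
  by exists r => //; left; exists w.
exists p; first exact: ext_refl.
by right=> r w rp; apply/negP => cr; apply: no; exists r, w.
Qed.

Lemma decides_ext n p r : ext r p -> decides n p -> decides n r.
Proof.
move=> rp [[w cw]|no]; [left; exists w; exact: converges_ext rp cw|right=> q w qr].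
exact/no/(ext_trans qr rp).
Qed.

Lemma diagonalizes_dense c p : exists2 r, ext r p & diagonalizes c r.
Proof.
(* The index stores [p] itself, so every candidate of this row is an extension of [p]. *)
pose e := npair c p; have e1 : nfst e = c by rewrite npairK1.
have e2 : nsnd e = p by rewrite npairK2.
have [[u pu]|no] := pselect (exists u, forall x, plausible x e u).
  have [v [t [pv tP]]] := guess_limit pu; exists (nfst v).
    by have /and3P[] := pv 0; rewrite e2.
  by exists e => //; left; exists v, t; split=> //; apply: ext_refl.
exists p; first exact: ext_refl.
exists e => //; right; split; last by rewrite e2 ext_refl.
move=> u; apply: contrapT => /forallNP h; apply: no; exists u => x.
exact/negPn/negP/h.
Qed.

Lemma eventually_all (P : nat -> nat -> Prop) (L : seq nat) :
  (forall z s t, s <= t -> P z s -> P z t) -> (forall z, exists s, P z s) ->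
  exists s, forall z, z \in L -> P z s.
Proof.
move=> Pmono Pex; elim: L => [|z L [s sP]]; first by exists 0.
have [t tP] := Pex z; exists (maxn s t) => x; rewrite in_cons.
case/orP => [/eqP ->|/sP]; apply: Pmono; [|exact: tP|]; lia.
Qed.

Definition separates (P : set nat) : Prop :=
  forall i t, ((forall x, t <= x -> guess i x) -> i \in P) /\
              ((forall x, t <= x -> ~~ guess i x) -> i \notin P).

(** * No separator is computable in the jump along a generic chain *)

Section GenericChain.
Context (pi : nat -> nat) (X : set nat)
  (pi_ext : forall s t, s <= t -> ext (pi t) (pi s))
  (fact_pi : forall s n m, fact (pi s) n m -> m = (n \in X))
  (pi_fact : forall n, exists s, fact (pi s) n (n \in X))
  (pi_decides : forall n, exists s, decides n (pi s))
  (pi_diagonalizes : forall c, exists s, diagonalizes c (pi s)).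

Lemma converges_jump s w n : converges (pi s) w n -> n \in jump X.
Proof.
move=> /andP[/hasP[k _ /andP[/hasP[z zk /andP[/eqP z1 /eqP z2]] ck]]].
move=> /hasP[l _ /andP[nl cl]]; have [c cn] := code_list_sound cl nl.
rewrite inE; exists (nsnd (nsnd z)), c => //.
apply: (@computation_sound X (fact (pi s)) (ldec k)) => //.
  by move=> i m _; apply: fact_pi.
by rewrite cn (_ : triple _ _ _ = z) // /triple -{1}z1 -z2 !npairK.
Qed.

(** A halting computation asks for finitely many bits, all settled at one stage of the chain. *)
Lemma jump_converges n : n \in jump X -> exists s w, converges (pi s) w n.
Proof.
rewrite inE => -[m [c cn cm]]; have [L Lm cL] := computation_complete cm.
have [K Kc cK] := code_list_complete c.
have [] := @eventually_all (fun z s => nfst z = npair 4 0 ->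
    answer X (nfst (nsnd z)) (nsnd (nsnd z)) ->
    fact (pi s) (nfst (nsnd z)) (nsnd (nsnd z))) L.
- by move=> z s t st h z4 /(h z4); apply/fact_ext/pi_ext.
- move=> z; have [s sP] := pi_fact (nfst (nsnd z)).
  by exists s => _ /eqP ->.
move=> s sP; exists s, (maxn (lcode L) (lcode K)).+1.
apply/andP; split; apply/hasP.
  exists (lcode L); first by rewrite mem_iota; lia.
  rewrite lcodeK; apply/andP; split.
    by apply/hasP; exists (triple (code_num c) n m);
      rewrite // /triple !(npairK1, npairK2) cn !eqxx.
  apply/allP => z zL; have := allP cL z zL.
  by apply: eq_justified; apply: sP.
exists (lcode K); first by rewrite mem_iota; lia.
by rewrite lcodeK -cn Kc.
Qed.

Lemma no_separator P : P <=T jump X -> ~ separates P.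
Proof.
move=> [c cP] sepP; have [s [e ec]] := pi_diagonalizes (code_num c).
case=> [[u [t [pu tP su]]]|[no se]]; last first.
  (* Case where nothing is forced: the computation of [c] at [e] asks finitely many questions about
     the jump, and one stage of the chain with one bound [w] forces all the answers ([ans]). This
     yields a candidate that stays plausible forever. *)
  have [L Le cL] := computation_complete (cP e).
  pose ans z r w := nfst z = npair 4 0 ->
    answer (jump X) (nfst (nsnd z)) (nsnd (nsnd z)) ->
    if nfst (nsnd z) \in jump X then is_true (converges r w (nfst (nsnd z)))
    else forall q w', ext q r -> ~~ converges q w' (nfst (nsnd z)).
  have ans_mono z r r' w w' : ext r' r -> w <= w' -> ans z r w -> ans z r' w'.
    move=> r'r ww' h z4 za; have := h z4 za; case: ifP => _.
      by move=> /(converges_ext r'r); apply: converges_leq.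
    by move=> no_r q y /ext_trans/(_ r'r)/no_r.
  have [||s' s'P] := @eventually_all (fun z s => exists w, ans z (pi s) w) L.
  - move=> z i j ij [w zw]; exists w; apply: ans_mono zw => //; exact: pi_ext.
  - move=> z; case: (boolP (nfst (nsnd z) \in jump X)) => [zX|zX].
      have [i [w iw]] := jump_converges zX.
      by exists i, w => _ _; rewrite zX.
    have [i [[w iw]|h]] := pi_decides (nfst (nsnd z)).
      by rewrite (converges_jump iw) in zX.
    by exists i, 0 => _ _; rewrite (negbTE zX) => q w'; apply: h.
  pose q := pi (maxn s s').
  have [||w wP] := @eventually_all (fun z w => z \in L -> ans z q w) L.
  - by move=> z i j ij h zL; apply: ans_mono (h zL) => //; apply: ext_refl.
  - move=> z; case: (boolP (z \in L)) => [/s'P [w zw]|_]; last by exists 0.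
    exists w => _; apply: ans_mono zw => //; apply: pi_ext; exact: leq_maxr.
  have [x /negP[]] := no (npair q (npair w (npair (e \in P) (lcode L)))).
  rewrite /plausible !(npairK1, npairK2) lcodeK ec Le; apply/and3P; split=> //.
    apply: ext_trans se; apply: pi_ext; exact: leq_maxl.
  apply/allP => z zL; have := allP cL z zL; apply: eq_justified => z4 za.
  have := wP z zL zL z4 za; rewrite /jump_fact !(npairK1, npairK2).
  move/eqP: za => ->; case: ifP => _; first by move=> ->.
  by move=> h /=; apply/allP => r _; apply/implyP => /h ->.
pose q := nfst u; pose w := nfst (nsnd u); pose l := nsnd (nsnd (nsnd u)).
(* The chain enters [q], so each false negative answer in [l] is refuted by a member of the chain;
   [x] exceeds the numbers of these members and the bounds of their computations. *)
have [||x xP] := @eventually_all (fun n x => n \in jump X ->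
    ~~ all (fun r => ext r q ==> ~~ converges r x n) (iota 0 x))
    [seq nfst (nsnd z) | z <- ldec l].
- move=> n x y xy h /h; apply: contra => /allP hy; apply/allP => r.
  rewrite mem_iota add0n => rx.
  have /hy : r \in iota 0 y by rewrite mem_iota; lia.
  by case: ext => //=; apply: contra; apply: converges_leq.
- move=> n; case: (boolP (n \in jump X)) => [nX|_]; last by exists 0.
  have [i [y iy]] := jump_converges nX; pose r := pi (maxn s i).
  have ry : converges r y n.
    apply: converges_ext iy; apply: pi_ext; exact: leq_maxr.
  have rq : ext r q.
    apply: ext_trans su; apply: pi_ext; exact: leq_maxl.
  exists (maxn r y).+1 => _; apply/negP => /allP/(_ r).
  rewrite mem_iota rq ltnS leq_maxl => /(_ isT)/negP; apply.
  by apply: converges_leq ry; lia.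
(* At stage [x] all answers used in [l] are true, so the forced value is the actual output of [c] at
   [e]. *)
have eP : value u = (e \in P).
  apply: eval_fun (cP e); have /and3P[_ eu cu] := pu x.
  apply: (computation_sound _ cu); last by rewrite -ec.
  move=> i k ik; rewrite /jump_fact !(npairK1, npairK2).
  have il : i \in [seq nfst (nsnd z) | z <- ldec l].
    by apply/mapP; eexists; first exact: ik; rewrite /triple npairK2 npairK1.
  case/orP => [/andP[/eqP -> iq]|/andP[/eqP -> h]].
    by rewrite (converges_jump (converges_ext su iq)).
  by case: (boolP (i \in jump X)) => // /(xP _ il); rewrite h.
have [pos neg] := sepP e t; case v0: (value u == 0).
  have eP1 : e \in P by apply: pos => x' /tP ->.
  by rewrite eP eP1 in v0.
have eP0 : e \notin P by apply: neg => x' /tP ->; rewrite v0.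
by rewrite eP (negbTE eP0) in v0.
Qed.

End GenericChain.

(** * Generic chains and the separating tree *)

Lemma infinite_natP (D : set nat) :
  infinite_set D <-> forall n, exists2 x, D x & n <= x.
Proof.
split=> [Dinf n|Dinf Dfin].
  apply: contrapT => no; apply: Dinf; apply: (@sub_finite_set _ _ `I_n).
    by move=> x Dx; rewrite /= ltnNge; apply/negP => nx; apply: no; exists x.
  exact: finite_II.
have [n nD] : exists n, forall x, D x -> x < n.
  have [s sD] := (finite_seqP D).1 Dfin; exists (\max_(x <- s) x).+1 => x.
  rewrite sD ltnS => xs; exact: (@leq_bigmax_seq _ s xpredT id).
by have [x /nD xn] := Dinf n; rewrite leqNgt xn.
Qed.

(** Met for all [k], this decides every bit of every column and of the cohesive set, and makes the
    latter infinite. *)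
Definition grown (k p : nat) : Prop :=
  [/\ k < size (cond p), forall i, i <= k -> k < size (str (cond p) i)
    & exists2 x, k <= x < size (stem p) & nth false (stem p) x].

Lemma grown_ext k p r : ext r p -> grown k p -> grown k r.
Proof.
move=> /asboolP[st [ss cP] _] [kp kcol [x /andP[kx xp] px]]; split.
- exact: leq_trans kp ss.
- move=> i ik; have [_ pre _] := cP i (leq_ltn_trans ik kp).
  exact: leq_trans (kcol i ik) (size_prefix pre).
- exists x; first by rewrite kx; apply: leq_trans xp (size_prefix st).
  by rewrite (prefix_nth st xp).
Qed.

Lemma grown_dense k p : exists2 r, ext r p & grown k r.
Proof.
(* [N] exceeds no column or stem position in use: columns are padded through [N] by their lock
   value, or 0 if unlocked, so that [N] is on the right side of each and may enter the stem. *)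
pose N := k + size (stem p) + sumn [seq size c.1 | c <- cond p].
pose p1 := cond p ++ nseq k.+1 ([::], None).
pose fill (c : seq bool * option bool) :=
  (c.1 ++ nseq (N.+1 - size c.1) (c.2 == Some true), c.2).
pose t' := stem p ++ nseq (N - size (stem p)) false ++ [:: true].
have [r [rt rp]] := condition_number t' [seq fill c | c <- p1].
have str_le c : c \in cond p -> size c.1 <= N.
  move=> cp; apply: leq_trans (leq_addl _ _).
  elim: (cond p) cp => //= d s IHs; rewrite in_cons => /orP[/eqP ->|/IHs]; lia.
have nth_r i : i < size p1 ->
    nth ([::], None) (cond r) i = fill (nth ([::], None) p1 i).
  by move=> ip; rewrite rp (nth_map ([::], None)).
have size_r i : i < size p1 -> size (str (cond r) i) = N.+1.
  move=> ip; rewrite /str nth_r //= size_cat size_nseq subnKC // leqW //.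
  rewrite /p1 nth_cat; case: ltnP => [ip0|_]; first exact/str_le/mem_nth.
  by rewrite nth_nseq; case: ifP.
have size_t' : size t' = N.+1.
  by rewrite /t' !size_cat size_nseq /= /N; lia.
have nth_t' x : size (stem p) <= x -> nth false t' x = (x == N).
  move=> px; have pN : size (stem p) <= N by rewrite /N; lia.
  rewrite /t' nth_cat ltnNge px /= nth_cat size_nseq nth_nseq.
  case: ltnP => xN; first by apply/esym/eqP; lia.
  case: eqP => [->|xN']; first by rewrite subnn.
  by rewrite nth_default //=; lia.
have nth_p i : i < size (cond p) ->
    nth ([::], None) p1 i = nth ([::], None) (cond p) i.
  by move=> ip; rewrite nth_cat ip.
have size_p1 : size p1 = size (cond p) + k.+1 by rewrite size_cat size_nseq.
exists r; last first.
  split; first by rewrite rp size_map size_p1; lia.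
    by move=> i ik; rewrite size_r ?size_p1 /N; lia.
  by exists N; rewrite rt ?size_t' ?nth_t' ?eqxx // /N; lia.
apply/asboolP; split.
- by rewrite rt prefix_prefix.
- split; first by rewrite rp size_map size_p1; lia.
  move=> i ip; have ip1 : i < size p1 by rewrite size_p1; lia.
  rewrite /lock /str nth_r // nth_p //=; split=> //; first exact: prefix_prefix.
  move=> b lb x /andP[px]; rewrite size_cat size_nseq => xN.
  rewrite nth_cat ltnNge px /= nth_nseq lb.
  by case: ltnP => [_|]; [case: (b)|lia].
- move=> x i /andP[px xr] rx ip.
  have ip1 : i < size p1 by rewrite size_p1; lia.
  move: rx; rewrite rt nth_t' // => /eqP xN; rewrite size_r // xN; split=> //.
  have cN := str_le _ (mem_nth ([::], None) ip).
  rewrite /side /lock /str nth_r // nth_p //= nth_cat ltnNge cN /= nth_nseq.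
  by case: ltnP => //; rewrite subSn // ltnn.
Qed.

(** Genericity concerns conditions only, so meeting a requirement below a pair [z] is turned into a
    dense set of conditions; choice then builds the chain. *)
Lemma generic_chain (Req : nat -> nat -> Prop) :
  (forall k p, exists2 r, ext r p & Req k r) ->
  for_sufficiently_generic (fun G => exists pi : nat -> nat,
    [/\ forall s, G (cond (pi s)), forall s, ext (pi s.+1) (pi s)
      & forall k, Req k (pi k.+1)]).
Proof.
move=> Req_dense.
pose D z := [set p | (exists2 q, cond q = p & ext q (nsnd z) /\ Req (nfst z) q)
  \/ ~ exists r, extends r p /\ extends r (cond (nsnd z))].
exists (range D); split.
- exact: card_image_le.
- move=> _ [z _ <-] p.
  have [[r [rp rz]]|no] := pselect (exists r, extends r p /\
    extends r (cond (nsnd z))); last by exists p; [right|exact: extends_refl].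
  (* Keeping the stem of [z] adds no element, so any extension of its condition gives an extension
     of the pair. *)
  have [q0 [q0t q0c]] := condition_number (stem (nsnd z)) r.
  have q0z : ext q0 (nsnd z).
    apply/asboolP; rewrite q0t q0c; split=> //; first exact: prefix_refl.
    by move=> x i /andP[zx]; rewrite ltnNge zx.
  have [q qq0 Rq] := Req_dense (nfst z) q0.
  exists (cond q); first by left; exists q => //; split=> //; apply: ext_trans q0z.
  by have /asboolP[_ + _] := qq0; rewrite q0c => /extends_trans; apply.
move=> G [[p0 Gp0] Gup Gdir] meets.
have step (z : nat * nat) : exists q, G (cond z.2) ->
    [/\ G (cond q), ext q z.2 & Req z.1 q].
  have [Gz|nGz] := pselect (G (cond z.2)); last by exists 0.
  have [|p [Gp]] := meets (D (npair z.1 z.2)); first by exists (npair z.1 z.2).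
  rewrite /D /= npairK1 npairK2 => -[[q qp [qz Rq]]|[]].
    by exists q => _; split=> //; rewrite qp.
  (* Two members of a filter are compatible, which excludes the second alternative in [D]. *)
  by have [r [_ rp rz]] := Gdir _ _ Gp Gz; exists r.
have [f fP] := choice step; have [q0 [_ q0c]] := condition_number [::] p0.
pose pi := nat_rect (fun=> nat) q0 (fun s q => f (s, q)).
have Gpi s : G (cond (pi s)).
  by elim: s => [|s IHs] /=; [rewrite q0c|have [] := fP (s, pi s) IHs].
by exists pi; split=> // s; have [] := fP (s, pi s) (Gpi s).
Qed.

Lemma mem_join (X Y : set nat) n :
  (n \in join X Y) = if odd n then n./2 \in Y else n./2 \in X.
Proof.
have n_half := odd_double_half n; apply/idP/idP.
  rewrite inE => -[[x Xx <-]|[y Yy <-]].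
    by rewrite odd_double doubleK inE.
  by rewrite /= odd_double uphalf_double inE.
rewrite inE; case: ifP n_half => _ n_half; rewrite inE => h.
  by right; exists n./2 => //; lia.
by left; exists n./2 => //; lia.
Qed.

Lemma generic_seqE (G : set condition) p i x :
  is_filter G -> G p -> i < size p -> x < size (str p i) ->
  (x \in generic_seq G i) = nth false (str p i) x.
Proof.
move=> [_ _ Gdir] Gp ip xp; apply/idP/idP => [|px]; last first.
  by rewrite inE; exists p.
rewrite inE => -[q [Gq iq xq qx]]; have [r [_ [_ rp] [_ rq]]] := Gdir _ _ Gp Gq.
have [_ pr _] := rp i ip; have [_ qr _] := rq i iq.
by rewrite -(prefix_nth pr xp) (prefix_nth qr xq).
Qed.

(** Bit 0 at [i] survives only while row [i] takes the value false beyond each [t] below the length,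
    and bit 1 only while it takes the value true. Rows without a limit leave the bit free. *)
Definition separating_tree : set (seq bool) :=
  [set s | forall i t, i < size s -> t < size s ->
    (`[< exists x, (t <= x) && ~~ guess i x >] || nth false s i) &&
    (`[< exists x, (t <= x) && guess i x >] || ~~ nth false s i)].

Lemma separating_tree_tree : tree separating_tree.
Proof.
move=> s u su uT i t si st; rewrite -(prefix_nth su si).
by apply: uT; apply: leq_trans (size_prefix su).
Qed.

Lemma separating_tree_infinite : infinite_set separating_tree.
Proof.
move=> /(finite_image size); apply/infinite_natP => n.
exists n => //.
(* The set of rows that are eventually true is a path. *)
exists (mkseq (fun i => `[< exists t, forall x, t <= x -> guess i x >]) n).
  move=> i t; rewrite size_mkseq => i_lt t_lt; rewrite nth_mkseq //.
  apply/andP; split.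
    case: asboolP => //= no; apply/asboolP; exists t => x tx.
    by apply/negPn/negP => gx; apply: no; exists x; rewrite tx.
  case: (asboolP (exists t, forall x, t <= x -> guess i x)) => [[t' t'P]|_];
    last by rewrite orbT.
  rewrite orbF; apply/asboolP; exists (maxn t t').
  by rewrite leq_maxl t'P // leq_maxr.
exact: size_mkseq.
Qed.

Lemma path_separates P : is_path separating_tree P -> separates P.
Proof.
move=> PT i t; pose n := (maxn i t).+1.
have := PT n i t; rewrite size_mkseq nth_mkseq ?ltnS ?leq_maxl ?leq_maxr //.
move=> /(_ isT isT) /andP[h1 h2]; split=> h; [move: h1|move: h2].
  case: asboolP => //= -[x /andP[tx]]; by rewrite h.
case: asboolP => //= -[x /andP[tx]]; by rewrite (negbTE (h x tx)).
Qed.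

Lemma separating_tree_le_jump Z :
  [set str_num s | s in separating_tree] <=T jump Z.
Proof.
rewrite turing_leE.
have neg_q : recb (jump Z) (fun z =>
    `[< exists x, (nsnd z <= x) && ~~ guess (nfst z) x >]).
  apply: (@recb_jump_exists Z (fun z x => (nsnd z <= x) && ~~ guess (nfst z) x)).
  have := recb_guess Z; move: guess => g cg; recs.
have pos_q : recb (jump Z) (fun z =>
    `[< exists x, (nsnd z <= x) && guess (nfst z) x >]).
  apply: (@recb_jump_exists Z (fun z x => (nsnd z <= x) && guess (nfst z) x)).
  have := recb_guess Z; move: guess => g cg; recs.
pose N i t := `[< exists x, (t <= x) && ~~ guess i x >].
pose P i t := `[< exists x, (t <= x) && guess i x >].
(* [str_num] is [lcode] on lists of bits, so numbers of strings are those with entries at most 1.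
   The two remaining questions are Sigma_1. *)
apply: (@eq_recb _ (fun n => all (fun a => a <= 1) (ldec n) &&
  all (fun i => all (fun t =>
    (N i t || (nth 0 (ldec n) i != 0)) && (P i t || (nth 0 (ldec n) i == 0)))
    (iota 0 (size (ldec n)))) (iota 0 (size (ldec n))))) => [n|].
  have strE s : str_num s = lcode (map nat_of_bool s).
    by elim: s => //= b s ->.
  apply/idP/idP.
    move=> /andP[/allP n1 /allP nT]; rewrite inE; exists (bits n).
      move=> i t; rewrite size_bits nth_bits => i_n t_n.
      have /nT/allP/(_ t) : i \in iota 0 (size (ldec n)) by rewrite mem_iota.
      by rewrite mem_iota negbK => /(_ t_n).
    rewrite strE -[RHS]ldecK; congr lcode; rewrite -map_comp map_id_in //.
    by move=> a /n1 /=; case: a => [|[]].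
  rewrite inE => -[s sT <-]; rewrite strE lcodeK; apply/andP; split.
    by apply/allP => _ /mapP[b _ ->]; case: b.
  have nthE i : (nth 0 (map nat_of_bool s) i == 0) = ~~ nth false s i.
    have [i_s|s_i] := ltnP i (size s); last by rewrite !nth_default ?size_map.
    by rewrite (nth_map false) //; case: nth.
  rewrite size_map; apply/allP => i; rewrite mem_iota => i_s.
  apply/allP => t; rewrite mem_iota => t_s; rewrite nthE negbK.
  exact: sT.
change (recb (jump Z) (fun z => N (nfst z) (nsnd z))) in neg_q.
change (recb (jump Z) (fun z => P (nfst z) (nsnd z))) in pos_q.
by move: N P neg_q pos_q => N P neg_q pos_q; recs.
Qed.

(** Each row is eventually constant along [D], so the jump can search for a bound [f i] beyond which
    [D] misses one of the two values, and tell which one. *)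
Lemma cohesive_separator X D :
  coh_solution (fun i => [set x | guess i x]) D -> D <=T X ->
  exists2 P, P <=T jump X & separates P.
Proof.
move=> [/infinite_natP Dinf Dcoh] DX; rewrite turing_leE in DX.
pose N i t := `[< exists x, [&& t <= x, x \in D & ~~ guess i x] >].
pose P i t := `[< exists x, [&& t <= x, x \in D & guess i x] >].
have cN : recb (jump X) (fun z => N (nfst z) (nsnd z)).
  apply: (@recb_jump_exists X (fun z x =>
    [&& nsnd z <= x, x \in D & ~~ guess (nfst z) x])).
  have := recb_guess X; move: guess => g cg; recs.
  by apply: (recf_comp DX); recs.
have cP : recb (jump X) (fun z => P (nfst z) (nsnd z)).
  apply: (@recb_jump_exists X (fun z x =>
    [&& nsnd z <= x, x \in D & guess (nfst z) x])).
  have := recb_guess X; move: guess => g cg; recs.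
  by apply: (recf_comp DX); recs.
have almost (Y : set nat) : almost_subset D Y ->
    exists t, forall x, t <= x -> D x -> Y x.
  move=> [F Ffin DFY]; apply: contrapT => no.
  suff : infinite_set F by [].
  apply/infinite_natP => n; apply: contrapT => noF; apply: no; exists n => x nx Dx.
  by apply: DFY; split=> // Fx; apply: noF; exists x.
have [||f cf fP] := @recf_choose (jump X) (fun i t => ~~ N i t || ~~ P i t).
- by recs.
- move=> i; case: (Dcoh i) => /almost [t tP]; exists t; apply/orP; [left|right].
    by apply/asboolPn => -[x /and3P[/tP + xD]]; rewrite inE in xD => /(_ xD) ->.
  apply/asboolPn => -[x /and3P[/tP + xD]]; rewrite inE in xD => /(_ xD).
  by move=> ngx /ngx.
exists [set i | ~~ N i (f i)].
  rewrite turing_leE; apply: (@eq_recb _ (fun i => ~~ N i (f i))) => [i|].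
    by apply/idP/idP; rewrite inE.
  by move: N cN {cP fP} => N cN; recs.
move=> i t; have [x Dx] := Dinf (maxn t (f i)).
rewrite geq_max => /andP[tx fx]; have xD : x \in D by rewrite inE.
split=> h.
  rewrite inE /=; apply/negP => Ni; have := fP i; rewrite Ni /= => /asboolPn [].
  by exists x; rewrite fx xD h.
apply/negP; rewrite inE /= => /asboolPn; apply.
by exists x; rewrite fx xD h.
Qed.

(** * The cohesive set built from a generic chain, and the conclusions *)

Theorem corollary3p4 :
  for_sufficiently_generic (fun G : set condition =>
    let R := generic_seq G in
    (exists C : set nat,
       [/\ infinite_set C,
           cohesive R C,
           ~ pa_relative (jump (join (seq_set R) C)) (jump set0)
         & ~ pa_relative (jump (join (seq_set R) C)) (jump (seq_set R))])
    /\ ~ coh_universal (seq_set R) R).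
Proof.
have [|DD [DDcount DDdense DDP]] := @generic_chain
    (fun k p => [/\ grown k p, decides k p & diagonalizes k p]).
  move=> k p; have [q qp gq] := grown_dense k p.
  have [r rq dr] := decides_dense k q; have [u ur du] := diagonalizes_dense k r.
  exists u; first exact: ext_trans ur (ext_trans rq qp).
  by split=> //; [apply: grown_ext gq; exact: ext_trans rq|apply: decides_ext dr].
exists DD; split=> // G Gfil meets R.
have [pi [Gpi pi_step pi_req]] := DDP G Gfil meets.
have pi_ext s t : s <= t -> ext (pi t) (pi s).
  elim: t => [|t IHt]; first by rewrite leqn0 => /eqP ->; apply: ext_refl.
  rewrite leq_eqVlt ltnS => /orP[/eqP ->|/IHt]; first exact: ext_refl.
  exact: ext_trans (pi_step t).
pose C := [set x | exists s, nth false (stem (pi s)) x].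
have stem_prefix s t : s <= t -> prefix (stem (pi s)) (stem (pi t)).
  by move=> /pi_ext/asboolP[].
have memC s x : x < size (stem (pi s)) -> (x \in C) = nth false (stem (pi s)) x.
  move=> xs; apply/idP/idP => [|sx]; last by rewrite inE; exists s.
  rewrite inE => -[t tx]; have xt : x < size (stem (pi t)).
    by rewrite ltnNge; apply/negP => h; rewrite nth_default in tx.
  have [st|/ltnW ts] := leqP s t.
    by rewrite -(prefix_nth (stem_prefix _ _ st)).
  by rewrite (prefix_nth (stem_prefix _ _ ts)).
have memR s i x : i < size (cond (pi s)) -> x < size (str (cond (pi s)) i) ->
    (x \in R i) = nth false (str (cond (pi s)) i) x.
  by move=> *; apply: generic_seqE.
pose X := join (seq_set R) C.
have memX n : (n \in X) = if odd n then n./2 \in C else nsnd n./2 \in R (nfst n./2).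
  by rewrite mem_join; case: odd => //; apply/idP/idP; rewrite !inE.
have fact_pi s n m : fact (pi s) n m -> m = (n \in X).
  rewrite /fact memX; case: ifP => _.
    by move=> /andP[hs /eqP ->]; rewrite (memC s).
  by move=> /and3P[is_ xs /eqP ->]; rewrite (memR s).
have pi_fact n : exists s, fact (pi s) n (n \in X).
  rewrite /fact memX; case: ifP => _.
    exists n./2.+1; have [[_ _ [x /andP[hx xs] _]] _ _] := pi_req n./2.
    have hs := leq_ltn_trans hx xs.
    by rewrite hs (memC n./2.+1) //=.
  set i := nfst _; set x := nsnd _; pose k := maxn i x.
  exists k.+1; have [[ks kstr _] _ _] := pi_req k.
  have ik : i < size (cond (pi k.+1)) by apply: leq_ltn_trans ks; exact: leq_maxl.
  have xk : x < size (str (cond (pi k.+1)) i).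
    by apply: leq_ltn_trans (kstr i (leq_maxl _ _)); exact: leq_maxr.
  by rewrite ik xk (memR k.+1) //=.
have no_sep P : P <=T jump X -> ~ separates P.
  apply: (no_separator pi_ext fact_pi pi_fact).
    by move=> n; exists n.+1; have [] := pi_req n.
  by move=> c; exists c.+1; have [] := pi_req c.
have Cinf : infinite_set C.
  apply/infinite_natP => n; have [[_ _ [x /andP[nx _] cx]] _ _] := pi_req n.
  by exists x => //; exists n.+1.
have Ccoh : cohesive R C.
  move=> i; have [[is_ _ _] _ _] := pi_req i; set s := i.+1 in is_.
  (* Column [i] exists at stage [s]; every later element of [C] obeys its lock. The finite exception
     is the set of positions of the stem at that stage. *)
  have C_side x : size (stem (pi s)) <= x -> C x ->
      (x \in R i) = side (cond (pi s)) i.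
    move=> sx [t tx]; have xt : x < size (stem (pi t)).
      by rewrite ltnNge; apply/negP => h; rewrite nth_default in tx.
    have st : s <= t.
      rewrite leqNgt; apply/negP => /ltnW /stem_prefix/size_prefix h.
      by rewrite ltnNge (leq_trans h sx) in xt.
    have /asboolP[_ [ss _] /(_ x i)] := pi_ext _ _ st.
    rewrite sx xt => /(_ isT tx is_) [xi <-]; apply: memR => //.
    exact: leq_trans is_ ss.
  case bE: (side (cond (pi s)) i); [left|right];
    exists `I_(size (stem (pi s))); try exact: finite_II;
    move=> x [Cx /negP]; rewrite -leqNgt => /C_side/(_ Cx); rewrite bE.
    by move/set_mem.
  by move=> xR Rx; move: xR; rewrite mem_set.
(* The tree is computable in every jump, so one argument serves both the empty set and the generic
   sequence. *)
have no_pa Z : ~ pa_relative (jump X) (jump Z).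
  move=> /(_ _ separating_tree_tree separating_tree_infinite
    (separating_tree_le_jump Z)) [P /path_separates sepP PX].
  exact: no_sep sepP.
split; first by exists C; split.
(* The rows of [guess] form a computable instance; a solution computable in [X] would give a
   separator computable in the jump of [X]. *)
move=> [_ univ]; have [||D Dsol DX] := univ (fun i => [set x | guess i x]) _ C.
- rewrite turing_leE.
  apply: (@eq_recb _ (fun n => guess (nfst n) (nsnd n))) => [n|].
    by apply/idP/idP; rewrite inE.
  exact: recb_guess.
- by split.
have [P PX sepP] := cohesive_separator Dsol DX.
exact: no_sep sepP.
Qed.
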